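(* Every locally solvable subgroup of $\mathrm{PL}_o(I)$ is countable.
   Context: $I=[0,1]$. $\mathrm{PL}_o(I)$ is the group, under composition, of piecewise linear orientation-preserving homeomorphisms of $I$ with finitely many breakpoints (points of non-differentiability). A group is locally solvable if every finitely generated subgroup of it is solvable. *)

(* Defs.v *)
From HB Require Import structures.
From mathcomp Require Import all_boot all_order all_algebra.
From mathcomp Require Import all_classical all_reals all_analysis.

Set Implicit Arguments.
Unset Strict Implicit.
Unset Printing Implicit Defensive.

Import Order.TTheory GRing.Theory Num.Theory.
Import numFieldNormedType.Exports.

Local Open Scope classical_set_scope.
Local Open Scope ring_scope.

Section GroupNotions.
Variable G : groupType.
Implicit Types H K A : set G.

Definition subgroup H : Prop := group_closed (mem H).

Definition generated A : set G := smallest subgroup A.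

Definition finitely_generated H : Prop :=
  exists2 A : set G, finite_set A & H = generated A.

Definition derived_subgroup H : set G :=
  generated [set [~ x, y]%g | x in H & y in H].

Definition derived_series (n : nat) H : set G := iter n derived_subgroup H.

Definition solvable_subgroup H : Prop :=
  exists n : nat, derived_series n H = [set 1%g].

Definition locally_solvable H : Prop :=
  forall K, subgroup K -> K `<=` H -> finitely_generated K ->
    solvable_subgroup K.

End GroupNotions.

(* A set used as a type is [set_type], whose topology is the induced one. *)
Notation unit_itv R := (set_type (`[0%R, 1%R]%classic : set R)).

Section PiecewiseLinear.
Variable R : realType.
Local Notation I := (unit_itv R).
Implicit Types f g : I -> I.

Definition homeomorphism f : Prop :=
  continuous f /\
  exists g, [/\ continuous g, cancel f g & cancel g f].

Definition orientation_preserving f : Prop :=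
  forall x y : I, \val x < \val y -> \val (f x) < \val (f y).

Definition affine_on f (u v : R) : Prop :=
  exists a b : R, forall x : I, u <= \val x <= v -> \val (f x) = a * \val x + b.

(* The breakpoints are among the points of the partition 0 = t_0 < ... < t_n = 1
   where t = 0 :: s. *)
Definition piecewise_linear f : Prop :=
  exists s : seq R, itv_partition 0 1 s /\
    forall i : nat, (i < size s)%N -> affine_on f (0 :: s)`_i (0 :: s)`_i.+1.

Definition PLo_homeo : set (I -> I) :=
  [set f | [/\ homeomorphism f, orientation_preserving f & piecewise_linear f]].

Lemma unit_itvP (x : I) : 0 <= \val x <= 1.
Proof. by case: x => x /= /set_mem; rewrite /= in_itv. Qed.

Lemma unit_itv_ex (u : R) : 0 <= u <= 1 -> exists x : I, \val x = u.
Proof.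
move=> u01; have uI : u \in (`[0, 1]%classic : set R) by rewrite inE /= in_itv.
by exists (exist _ u uI).
Qed.

Let partition_locate (s : seq R) (a u : R) :
  path <%R a s -> a <= u -> u < last a s ->
  exists2 i, (i < size s)%N & (a :: s)`_i <= u < (a :: s)`_i.+1.
Proof.
elim: s a => [|b s IH] a /=; first by move=> _ au /(le_lt_trans au); rewrite ltxx.
move=> /andP[ab bs] au ul; have [ub|bu] := ltP u b.
  by exists 0%N => //=; rewrite au ub.
by have [i si ui] := IH _ bs bu ul; exists i.+1.
Qed.

Let partition_of (B : seq R) :
  exists2 s : seq R, itv_partition 0 1 s &
    forall i b, (i < size s)%N -> b \in B ->
      ~ ((0 :: s)`_i < b < (0 :: s)`_i.+1).
Proof.
pose B' : seq R := sort <=%R (undup [seq b <- B | 0 < b < 1]).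
have memB' b : (b \in B') = (0 < b < 1) && (b \in B).
  by rewrite mem_sort mem_undup mem_filter.
have pB' : path <%R 0 B'.
  rewrite path_sortedE; last exact: lt_trans.
  rewrite sort_lt_sorted undup_uniq andbT.
  by apply/allP => b; rewrite memB' => /andP[/andP[]].
have ps : path <%R 0 (rcons B' 1).
  rewrite rcons_path pB' /=.
  have : last 0 B' \in 0 :: B' by exact: mem_last.
  rewrite inE => /orP[/eqP ->//|]; rewrite memB'.
  by case/andP => /andP[].
exists (rcons B' 1); first by split; rewrite ?last_rcons.
move=> i b si bB /andP[ib bi].
have srt : sorted <%R (0 :: rcons B' 1) by [].
have mono := lt_sorted_ltn_nth 0 srt.
have t0 : 0 <= (0 :: rcons B' 1)`_i.
  case: i si {ib bi} => [|i] // si; apply: ltW.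
  by rewrite [X in X < _](_ : _ = (0 :: rcons B' 1)`_0) // mono // inE /= ltnW.
have t1 : (0 :: rcons B' 1)`_i.+1 <= 1.
  have e1 : (0 :: rcons B' 1)`_(size (rcons B' 1)) = 1.
    by rewrite size_rcons /= nth_rcons ltnn eqxx.
  rewrite -[leRHS]e1.
  rewrite le_eqVlt; have := si; rewrite leq_eqVlt => /orP[/eqP <-|si'].
    by rewrite eqxx.
  by rewrite mono ?inE ?si' ?orbT //=.
have : b \in 0 :: rcons B' 1.
  rewrite inE mem_rcons inE memB' bB andbT.
  by rewrite (le_lt_trans t0 ib) (lt_le_trans bi t1) !orbT.
case/(nthP 0) => j sj jb.
move: ib bi; rewrite -jb !mono ?inE //=; last exact: ltnW.
by move=> ij; rewrite ltnS leqNgt ij.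
Qed.

Let piecewise_linearP f : piecewise_linear f <->
  exists B : seq R, forall u v : R, 0 <= u -> v <= 1 -> u < v ->
    (forall b, b \in B -> ~ (u < b < v)) -> affine_on f u v.
Proof.
split=> [[s [[ps /eqP ls] afs]]|[B afB]].
  exists s => u v u0 v1 uv Bs.
  have [] := partition_locate ps u0; first by rewrite ls (lt_le_trans uv v1).
  move=> i si /andP[iu ui]; have [a [b ab]] := afs i si.
  exists a, b => x /andP[ux xv]; apply: ab; rewrite (le_trans iu ux) /=.
  apply: (le_trans xv); rewrite leNgt; apply/negP => iv.
  by apply: (Bs (0 :: s)`_i.+1); rewrite ?ui ?iv //= mem_nth.
have [s ps Bs] := partition_of B.
exists s; split=> // i si; apply: afB.
- have := @itv_partition_nth_ge _ R 0 1 s i (ltnW si) ps.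
  by rewrite (set_nth_default 0) //= ltnW.
- have := @itv_partition_nth_le _ R 0 1 s i.+1 si ps.
  by rewrite (set_nth_default 0) //=.
- have [pl _] := ps; have srt : sorted <%R (0 :: s) by [].
  by rewrite (lt_sorted_ltn_nth 0 srt) ?inE //= ltnW.
- by move=> b; exact: Bs.
Qed.

Lemma PLo_homeo_id : PLo_homeo idfun.
Proof.
split; first by split; [|exists idfun; split]; move=> // x; exact: cvg_id.
- by [].
- apply/piecewise_linearP; exists [::] => u v _ _ _ _.
  by exists 1, 0 => x _; rewrite mul1r addr0.
Qed.

Let orientation_le f : orientation_preserving f ->
  forall x y : I, \val x <= \val y -> \val (f x) <= \val (f y).
Proof.
by move=> fo x y; rewrite le_eqVlt => /orP[/eqP/val_inj ->//|/fo/ltW].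
Qed.

Let orientation_inv f g : orientation_preserving f -> cancel g f ->
  orientation_preserving g.
Proof.
move=> fo gK x y xy; rewrite ltNge; apply/negP => /(orientation_le fo).
by rewrite !gK leNgt xy.
Qed.

Lemma PLo_homeo_comp f g : PLo_homeo f -> PLo_homeo g -> PLo_homeo (f \o g).
Proof.
move=> [[fc [f' [f'c fK f'K]]] fo fp] [[gc [g' [g'c gK g'K]]] go gp].
split.
- split; first by move=> x; apply: continuous_comp; [exact: gc|exact: fc].
  exists (g' \o f'); split; last 2 first.
  + exact: can_comp.
  + exact: can_comp.
  + by move=> x; apply: continuous_comp; [exact: f'c|exact: g'c].
- by move=> x y /go /fo.
- move/piecewise_linearP: fp => [Bf afBf]; move/piecewise_linearP: gp => [Bg afBg].
  apply/piecewise_linearP.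
  pose h (b : R) : R := oapp (fun y : I => \val (g' y)) 0 (insub b).
  exists (Bg ++ [seq h b | b <- Bf]) => u v u0 v1 uv Bn.
  have [|a [b ab]] := afBg u v u0 v1 uv.
    by move=> b bB; apply: Bn; rewrite mem_cat bB.
  have [|x xu] := @unit_itv_ex u; first by rewrite u0 ltW // (lt_le_trans uv).
  have [|y yv] := @unit_itv_ex v; first by rewrite v1 ltW // (le_lt_trans u0).
  have /andP[gx0 _] := unit_itvP (g x); have /andP[_ gy1] := unit_itvP (g y).
  have [||c [d cd]] := afBf (\val (g x)) (\val (g y)) gx0 gy1.
  + by apply: go; rewrite xu yv.
  + move=> t tB /andP[xt ty].
    have [|z zt] := @unit_itv_ex t.
      by rewrite (le_trans gx0 (ltW xt)) (le_trans (ltW ty) gy1).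
    apply: (Bn (h t)); first by rewrite mem_cat map_f ?orbT.
    have -> : h t = \val (g' z) by rewrite /h -zt valK.
    have g'o := orientation_inv go g'K.
    move: xt ty; rewrite -zt => /g'o + /g'o.
    by rewrite !gK xu yv => -> ->.
  + exists (c * a), (c * b + d) => z /andP[uz zv] /=.
    rewrite cd; first by rewrite ab ?uz // mulrDr mulrA addrA.
    by rewrite !(orientation_le go) ?xu ?yv.
Qed.

Lemma PLo_homeo_inv f : PLo_homeo f ->
  exists g, [/\ PLo_homeo g, cancel f g & cancel g f].
Proof.
move=> [[fc [g [gc fK gK]]] fo fp]; exists g; split=> //.
have go := orientation_inv fo gK.
split=> //; first by split=> //; exists f.
move/piecewise_linearP: fp => [B afB]; apply/piecewise_linearP.
pose h (b : R) : R := oapp (fun y : I => \val (f y)) 0 (insub b).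
exists [seq h b | b <- B] => u v u0 v1 uv Bn.
have [|x xu] := @unit_itv_ex u; first by rewrite u0 ltW // (lt_le_trans uv).
have [|y yv] := @unit_itv_ex v; first by rewrite v1 ltW // (le_lt_trans u0).
have /andP[gx0 _] := unit_itvP (g x); have /andP[_ gy1] := unit_itvP (g y).
have gxy : \val (g x) < \val (g y) by apply: go; rewrite xu yv.
have [|a [b ab]] := afB (\val (g x)) (\val (g y)) gx0 gy1 gxy.
  move=> t tB /andP[xt ty].
  have [|z zt] := @unit_itv_ex t.
    by rewrite (le_trans gx0 (ltW xt)) (le_trans (ltW ty) gy1).
  apply: (Bn (h t)); first by rewrite map_f.
  have -> : h t = \val (f z) by rewrite /h -zt valK.
  move: xt ty; rewrite -zt => /fo + /fo.
  by rewrite !gK xu yv => -> ->.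
have abz z : u <= \val z <= v -> \val z = a * \val (g z) + b.
  move=> /andP[uz zv]; rewrite -{1}(gK z); apply: ab.
  by rewrite !(orientation_le go) ?xu ?yv.
have a0 : a != 0.
  apply/eqP => a0.
  have ub : u = b by rewrite -xu abz ?xu ?lexx ?(ltW uv) // a0 mul0r add0r.
  have vb : v = b by rewrite -yv abz ?yv ?lexx ?(ltW uv) // a0 mul0r add0r.
  by move: uv; rewrite ub vb ltxx.
exists a^-1, (- (a^-1 * b)) => z /abz ->.
by rewrite mulrDr mulKf // addrK.
Qed.

End PiecewiseLinear.

Definition PLo (R : realType) : Type := set_type (@PLo_homeo R).

Section PLoGroup.
Variable R : realType.
Local Notation I := (unit_itv R).
Implicit Types f g : PLo R.

HB.instance Definition _ := Choice.on (PLo R).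

Definition PLo_fun f : I -> I := sval f.
Coercion PLo_fun : PLo >-> Funclass.

Lemma PLo_ext f g : PLo_fun f = PLo_fun g -> f = g.
Proof. exact: val_inj. Qed.

Let PLoP f : PLo_homeo f.
Proof. exact: set_mem (svalP f). Qed.

Definition PLo_one : PLo R := exist _ idfun (mem_set (@PLo_homeo_id R)).

Definition PLo_mul f g : PLo R :=
  exist _ (f \o g) (mem_set (PLo_homeo_comp (PLoP f) (PLoP g))).

Let PLo_inv_spec f :
  {g : I -> I | [/\ PLo_homeo g, cancel f g & cancel g f]}.
Proof. exact: cid (PLo_homeo_inv (PLoP f)). Qed.

Let PLo_inv_homeo f : PLo_homeo (sval (PLo_inv_spec f)).
Proof. by case: (PLo_inv_spec f) => g []. Qed.

Definition PLo_inv f : PLo R :=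
  exist _ (sval (PLo_inv_spec f)) (mem_set (PLo_inv_homeo f)).

Let PLo_mulA : associative PLo_mul.
Proof. by move=> f g h; apply: PLo_ext. Qed.

Let PLo_mul1 : left_id PLo_one PLo_mul.
Proof. by move=> f; apply: PLo_ext. Qed.

Let PLo_mulr1 : right_id PLo_one PLo_mul.
Proof. by move=> f; apply: PLo_ext. Qed.

Let PLo_mulV : left_inverse PLo_one PLo_inv PLo_mul.
Proof.
move=> f; apply: PLo_ext; apply: funext => x /=.
by case: (PLo_inv_spec f) => g [] /= _ fK _; exact: fK.
Qed.

Let PLo_mulrV : right_inverse PLo_one PLo_inv PLo_mul.
Proof.
move=> f; apply: PLo_ext; apply: funext => x /=.
by case: (PLo_inv_spec f) => g [] /= _ _ gK; exact: gK.
Qed.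

HB.instance Definition _ := isGroup.Build (PLo R)
  PLo_mulA PLo_mul1 PLo_mulr1 PLo_mulV PLo_mulrV.

End PLoGroup.

Lemma PLo_mulE (R : realType) (f g : PLo R) : PLo_fun (f * g)%g = f \o g.
Proof. by []. Qed.

Lemma PLo_1E (R : realType) : PLo_fun (1%g : PLo R) = idfun.
Proof. by []. Qed.

(* Main.v *)
Require Import Defs.
From mathcomp Require Import all_boot all_order all_algebra.
From mathcomp Require Import all_classical all_reals all_analysis.
From mathcomp Require Import lra.

(* The group acts on the line, fixing all points outside of a bounded interval; an
   orbital of [f] is a maximal interval on which [f] has no fixed point.

   Two orbitals of elements of a locally solvable group [H] never cross. Suppose
   that [(a, b)] is an orbital of [g], [(c, d)] one of [h], and [a < c < b < d], and
   let [K = <g, h>]. A point at which all elements of [K] commute cannot lie in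
   [(a, d)]: in [(a, b)], say, its iterates under [g] accumulate at [b], which would
   be such a point as well, and then [h b] or [h^-1 b] would be fixed by [g]. So
   [K'] moves all points of [(a, q)], where [q] is the first such point after [d];
   and an induction shows that all further derived subgroups do so, because elements
   of [K'] are the identity near [q] and because a piecewise linear function cannot
   alternately move and fix the terms of a convergent monotone sequence.

   Hence the orbitals are pairwise equal, disjoint or strictly nested (sharing no
   endpoint). If [(a, b)] is an orbital of [f] containing [q], then [f] moves all
   smaller orbitals containing [q] off themselves, so that they end before [f q];
   this gap [(f q, b)] contains a rational number, and there are only countably many
   orbitals. The countable set [E] of their endpoints is invariant under [H].

   Next, only countably many lines contain a segment of the graph of an element of
   [H]. Above an interval with two points of [E] this is clear. Otherwise consider an
   interval [J] without points of [E]: either each element of [H] that maps [J] to an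
   interval meeting [J] is the identity on [J], or [J] lies in an orbital [A] without
   points of [E]. In the latter case the stabilizer of [A] acts freely (or trivially)
   on [A], hence commutatively there, and it is countable since each of its elements
   maps some breakpoint of a power of [f] to another one.

   Finally, all breakpoints of elements of [H] are intersections of two such lines,
   and an element is determined by its values at its breakpoints. *)

Set Implicit Arguments.
Unset Strict Implicit.
Unset Printing Implicit Defensive.

Import Order.TTheory GRing.Theory Num.Theory.

Local Open Scope classical_set_scope.
Local Open Scope ring_scope.

(** * Piecewise affine functions *)

Section AffinePieces.
Variable R : realType.
Implicit Types F : R -> R.

Definition affine_itv F (u v : R) : Prop :=
  exists al be : R, forall x, u <= x <= v -> F x = al * x + be.

(** Pieces are affine on closed intervals, so neighbouring ones agree at a common end: continuity is
    built in. [B] may contain more than the breakpoints. *)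
Definition affine_off F (B : seq R) : Prop :=
  forall u v, u < v -> (forall b, b \in B -> ~ (u < b < v)) -> affine_itv F u v.

Definition locally_affine F (t : R) : Prop :=
  exists u v, [/\ u < t, t < v & affine_itv F u v].

Lemma affine_itvS F u v u' v' : u <= u' -> v' <= v ->
  affine_itv F u v -> affine_itv F u' v'.
Proof.
move=> uu vv [al [be E]]; exists al, be => x /andP[xu xv].
by apply: E; rewrite (le_trans uu) // (le_trans xv).
Qed.

Lemma affine_coef_uniq (al be al' be' x y : R) : x < y ->
  al * x + be = al' * x + be' -> al * y + be = al' * y + be' ->
  al = al' /\ be = be'.
Proof.
move=> xy ex ey.
have e : al = al'.
  apply/eqP; rewrite -subr_eq0; have : (al - al') * (y - x) = 0.
    by rewrite mulrBl !mulrBr; lra.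
  by move/eqP; rewrite mulf_eq0 => /orP[//|/eqP yx]; lra.
by split=> //; move: ex; rewrite e => /addrI.
Qed.

Lemma affine_eq2 F F' u v x y : affine_itv F u v -> affine_itv F' u v ->
  u <= x -> x < y -> y <= v -> F x = F' x -> F y = F' y ->
  forall t, u <= t <= v -> F t = F' t.
Proof.
move=> [al [be E]] [al' [be' E']] ux xy yv ex ey t tuv.
have ix : u <= x <= v by apply/andP; split; lra.
have iy : u <= y <= v by apply/andP; split; lra.
move: ex ey; rewrite (E x) // (E y) // (E' x) // (E' y) // => ex ey.
by have [e1 e2] := affine_coef_uniq xy ex ey; rewrite E // E' // e1 e2.
Qed.

Lemma affine_glue F u v x y : u <= x -> x < y -> y <= v ->
  affine_itv F u y -> affine_itv F x v -> affine_itv F u v.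
Proof.
move=> ux xy yv [al [be E]] [al' [be' E']].
have [||e1 e2] := @affine_coef_uniq al be al' be' x y xy.
- by rewrite -E -?E' //; apply/andP; split; lra.
- by rewrite -E -?E' //; apply/andP; split; lra.
exists al, be => t /andP[tu tv]; have [ty|yt] := leP t y.
  by rewrite E // tu.
by rewrite E' ?e1 ?e2 //; apply/andP; split; lra.
Qed.

Lemma affine_off_locally F B : affine_off F B ->
  forall x y, (forall t, x < t < y -> t \in B -> locally_affine F t) ->
  affine_itv F x y.
Proof.
move=> FB x y.
(* Restricting the hypothesis to subintervals of [[x, y]] lets the points of [B'] be removed one by
   one: at each, the two adjacent pieces are glued through a neighbourhood on which [F] is
   affine. *)
suff: forall B' : seq R, (forall u v, x <= u -> u < v -> v <= y ->
    (forall b, b \in B' -> ~ (u < b < v)) -> affine_itv F u v) ->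
  (forall t, x < t < y -> t \in B' -> locally_affine F t) -> affine_itv F x y.
  by apply => u v _ uv _; exact: FB.
elim=> [|b B' IH] FB' lF.
  have [xy|yx] := ltP x y; first exact: FB'.
  exists 0, (F x) => t /andP[xt ty].
  by rewrite mul0r add0r (_ : t = x) //; apply/eqP; rewrite eq_le; apply/andP; split; lra.
apply: IH => [u v xu uv vy uvB|t txy tB]; last first.
  by apply: lF => //; rewrite inE tB orbT.
have [/andP[ub bv]|bN] := boolP (u < b < v); last first.
  by apply: FB' => // b'; rewrite inE => /orP[/eqP -> /(negP bN)|/uvB].
have Bl : affine_itv F u b.
  apply: FB' => //; first lra; move=> b'; rewrite inE => /orP[/eqP ->|/uvB b'N].
    by rewrite ltxx andbF.
  by move=> /andP[? ?]; apply: b'N; apply/andP; split; lra.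
have Br : affine_itv F b v.
  apply: FB' => //; first lra; move=> b'; rewrite inE => /orP[/eqP ->|/uvB b'N].
    by rewrite ltxx.
  by move=> /andP[? ?]; apply: b'N; apply/andP; split; lra.
have [||u' [v' [u'b bv' lb]]] := lF b.
- by apply/andP; split; lra.
- by rewrite inE eqxx.
pose w := Num.max u u'; pose w' := Num.min v v'.
have [wu wu'] : u <= w /\ u' <= w by rewrite /w !le_max !lexx orbT.
have [wv wv'] : w' <= v /\ w' <= v' by rewrite /w' !ge_min !lexx orbT.
have wb : w < b by rewrite /w gt_max ub u'b.
have bw : b < w' by rewrite /w' lt_min bv bv'.
apply: (@affine_glue _ u v b w') => //; first lra.
apply: (@affine_glue _ u w' w b) => //; first lra.
by apply: affine_itvS lb.
Qed.

Lemma avoid_right (B : seq R) x : exists2 v, x < v &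
  forall b, b \in B -> ~ (x < b < v).
Proof.
elim: B => [|b B [v xv IH]]; first by exists (x + 1) => //; lra.
have [xb|bx] := ltP x b.
  exists (Num.min v b); first by rewrite lt_min xv.
  move=> b'; rewrite inE lt_min => /orP[/eqP ->|/IH h].
    by rewrite ltxx !andbF.
  by move=> /and3P[h1 h2 h3]; apply: h; rewrite h1.
exists v => // b'; rewrite inE => /orP[/eqP ->|/IH //].
by rewrite ltNge bx.
Qed.

Lemma avoid_left (B : seq R) x : exists2 u, u < x &
  forall b, b \in B -> ~ (u < b < x).
Proof.
have [v xv vB] := avoid_right (map -%R B) (- x).
exists (- v); first lra.
move=> b bB /andP[h1 h2]; apply: (vB (- b)); first exact: map_f.
by apply/andP; split; lra.
Qed.

Lemma affine_off_right F B x : affine_off F B ->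
  exists2 v, x < v & affine_itv F x v.
Proof. by move=> FB; have [v xv h] := avoid_right B x; exists v => //; exact: FB. Qed.

Lemma affine_off_left F B x : affine_off F B ->
  exists2 u, u < x & affine_itv F u x.
Proof. by move=> FB; have [v xv h] := avoid_left B x; exists v => //; exact: FB. Qed.

Lemma affine_off_notin F B x : affine_off F B -> x \notin B ->
  locally_affine F x.
Proof.
move=> FB xB; have [v xv vB] := avoid_right B x; have [u ux uB] := avoid_left B x.
exists u, v; split=> //; apply: FB; first lra.
move=> b bB /andP[ub bv]; case: (ltgtP b x) => [bx|xb|e].
- by apply: (uB b); rewrite // ub.
- by apply: (vB b); rewrite // xb.
- by rewrite -e bB in xB.
Qed.

Lemma locally_affine_ext F F' a b x : a < x -> x < b ->
  (forall t, a < t < b -> F t = F' t) ->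
  locally_affine F x -> locally_affine F' x.
Proof.
move=> ax xb FF [u [v [ux xv [al [be E]]]]].
exists (Num.max u ((a + x) / 2)), (Num.min v ((x + b) / 2)); split.
- by rewrite gt_max ux; lra.
- by rewrite lt_min xv; lra.
exists al, be => t; rewrite ge_max le_min => /andP[/andP[h1 h2] /andP[h3 h4]].
by rewrite -FF ?E ?h1 //; apply/andP; split; lra.
Qed.

End AffinePieces.

(** * Piecewise linear actions on the line *)

Section Subgroups.
Variable G : groupType.
Implicit Types (H K A : set G) (f g : G).

Lemma subgroupP H : subgroup H <->
  [/\ H 1%g, forall f g, H f -> H g -> H (f * g)%g & forall f, H f -> H f^-1%g].
Proof.
have memE f : (f \in mem H) = (f \in H) by [].
split=> [sH|[H1 HM HV]].
  have [H1 _] := sH; split=> [|f g|f].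
  - by move: H1; rewrite memE inE.
  - by move=> Hf Hg; apply/set_mem; rewrite -memE (group_closedM sH) ?memE ?inE.
  - by move=> Hf; apply/set_mem; rewrite -memE (group_closedV sH) ?memE ?inE.
split=> [|f g]; rewrite !memE !inE // => Hf Hg.
exact/HM/HV.
Qed.

Lemma generated_subgroup A : subgroup (generated A).
Proof.
apply/subgroupP; split=> [|f g Af Ag|f Af] K [sK AK].
- by have /subgroupP[] := sK.
- by have /subgroupP[_ KM _] := sK; apply: KM; [apply: Af|apply: Ag].
- by have /subgroupP[_ _ KV] := sK; apply: KV; apply: Af.
Qed.

Lemma sub_generated A : A `<=` generated A.
Proof. by move=> f Af K [_]; exact. Qed.

Lemma generated_min A K : subgroup K -> A `<=` K -> generated A `<=` K.
Proof. by move=> sK AK f; apply. Qed.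

Lemma derived_sub H : subgroup H -> derived_subgroup H `<=` H.
Proof.
move=> sH; apply: generated_min => // _ /= [f Hf [g Hg <-]].
have /subgroupP[_ HM HV] := sH.
by apply: (HM _ _ (HV _ Hf)); apply: (HM _ _ (HV _ Hg)); apply: HM.
Qed.

End Subgroups.

Section PLActions.
Variables (R : realType) (G : groupType).

(** The bounds [m] and [M] are common to all elements, so that the whole group has common fixed
    points on both sides. *)
Record pl_action (act : G -> R -> R) : Prop := PLAction {
  pl_mul : forall f g x, act (f * g)%g x = act f (act g x);
  pl_1 : forall x, act 1%g x = x;
  pl_lt : forall f x y, x < y -> act f x < act f y;
  pl_bounded : exists m M, forall f x, x <= m \/ M <= x -> act f x = x;
  pl_affine : forall f, exists B, affine_off (act f) B }.

(** Conjugation by [x |-> - x]: it exchanges left and right, so that one-sided statements need one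
    proof only. *)
Definition mirror (act : G -> R -> R) f x := - act f (- x).

Lemma mirror_affine (F : R -> R) u v : affine_itv F u v ->
  affine_itv (fun x => - F (- x)) (- v) (- u).
Proof.
move=> [al [be E]]; exists al, (- be) => x /andP[h1 h2].
by rewrite E; [lra|apply/andP; split; lra].
Qed.

Lemma mirror_pl_action act : pl_action act -> pl_action (mirror act).
Proof.
move=> [M A1 L [m [M' bd]] P]; split; rewrite /mirror.
- by move=> f g x; rewrite opprK M.
- by move=> x; rewrite A1 opprK.
- by move=> f x y xy; rewrite ltrN2; apply: L; lra.
- by exists (- M'), (- m) => f x [h|h]; rewrite bd ?opprK //; [right|left]; lra.
- move=> f; have [B FB] := P f; exists (map -%R B) => u v uv uB.
  rewrite -(opprK u) -(opprK v); apply: mirror_affine.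
  apply: FB; first lra.
  move=> b bB /andP[h1 h2]; apply: (uB (- b)); first exact: map_f.
  by apply/andP; split; lra.
Qed.

Variables (act : G -> R -> R).

Definition orbital f (a b : R) : Prop :=
  [/\ a < b, act f a = a, act f b = b & forall x, a < x -> x < b -> act f x <> x].

Hypothesis actP : pl_action act.
Implicit Types (f g h : G) (H K : set G).

Let actM := pl_mul actP.
Let act1 := pl_1 actP.

Lemma actK f : cancel (act f) (act f^-1%g).
Proof. by move=> x; rewrite -actM mulVg act1. Qed.

Lemma actVK f : cancel (act f^-1%g) (act f).
Proof. by move=> x; rewrite -actM mulgV act1. Qed.

Lemma act_lt f x y : (act f x < act f y) = (x < y).
Proof.
apply/idP/idP; last exact: (pl_lt actP).
by move=> /(pl_lt actP f^-1%g); rewrite !actK.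
Qed.

Lemma act_le f x y : (act f x <= act f y) = (x <= y).
Proof. by rewrite !leNgt act_lt. Qed.

Lemma act_inj f : injective (act f).
Proof. exact: can_inj (actK f). Qed.

Lemma actV_lt f x y : (act f^-1%g x < y) = (x < act f y).
Proof. by rewrite -(act_lt f) actVK. Qed.

Lemma act_ltV f x y : (x < act f^-1%g y) = (act f x < y).
Proof. by rewrite -(act_lt f) actVK. Qed.

Lemma act_fixV f x : act f x = x -> act f^-1%g x = x.
Proof. by move=> {1}<-; rewrite actK. Qed.

Lemma act_fixX f x n : act f x = x -> act (f ^+ n)%g x = x.
Proof. by move=> fx; elim: n => [|n IH]; rewrite ?act1 // expgS actM IH. Qed.

Lemma actXS f n x : act (f ^+ n.+1)%g x = act f (act (f ^+ n)%g x).
Proof. by rewrite expgS actM. Qed.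

Lemma actXSr f n x : act (f ^+ n.+1)%g x = act (f ^+ n)%g (act f x).
Proof. by rewrite expgSr actM. Qed.

(** Monotonicity alone gives [sup S <= act g (sup S)]; apply this to [f] and to its inverse. *)
Lemma fix_sup (S : set R) f : has_sup S -> (forall s, S s -> act f s = s) ->
  act f (sup S) = sup S.
Proof.
move=> [S0 Sb].
have aux g : (forall s, S s -> act g s = s) -> sup S <= act g (sup S).
  move=> gS; apply: ge_sup => // s Ss.
  by rewrite -(gS s Ss) act_le; apply: sup_upper_bound.
move=> fS; apply/eqP; rewrite eq_le aux // andbT.
by rewrite -(act_le f^-1%g) actK aux // => s /fS; exact: act_fixV.
Qed.

Lemma fix_inf (S : set R) f : has_inf S -> (forall s, S s -> act f s = s) ->
  act f (inf S) = inf S.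
Proof.
move=> [S0 Sb].
have aux g : (forall s, S s -> act g s = s) -> act g (inf S) <= inf S.
  move=> gS; apply: lb_le_inf => // s Ss.
  by rewrite -(gS s Ss) act_le; apply: ge_inf.
move=> fS; apply/eqP; rewrite eq_le aux //=.
by rewrite -(act_le f^-1%g) actK aux // => s /fS; exact: act_fixV.
Qed.

Lemma orbital_ex f x : act f x <> x -> exists a b, [/\ a < x, x < b & orbital f a b].
Proof.
move=> fx; have [m [M bd]] := pl_bounded actP.
have mx : m < x by rewrite ltNge; apply/negP => h; apply: fx; apply: bd; left.
have xM : x < M by rewrite ltNge; apply/negP => h; apply: fx; apply: bd; right.
pose S := [set y | y <= x /\ act f y = y]; pose T := [set y | x <= y /\ act f y = y].
have hS : has_sup S.
  by split; [exists m; split; [exact: ltW|apply: bd; left]|exists x => y []].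
have hT : has_inf T.
  by split; [exists M; split; [exact: ltW|apply: bd; right]|exists x => y []].
have fS : act f (sup S) = sup S by apply: fix_sup => // s [].
have fT : act f (inf T) = inf T by apply: fix_inf => // s [].
have Sx : sup S < x.
  rewrite lt_neqAle; apply/andP; split; first by apply/eqP => e; rewrite e in fS.
  by apply: ge_sup; [exact: hS.1|move=> y []].
have xT : x < inf T.
  rewrite lt_neqAle; apply/andP; split; first by apply/eqP => e; rewrite -e in fT.
  by apply: lb_le_inf; [exact: hT.1|move=> y []].
exists (sup S), (inf T); split=> //; split=> //; first exact: lt_trans xT.
move=> y Sy yT fy; have [yx|xy] := leP y x.
  by have : y <= sup S by [apply: sup_upper_bound]; rewrite leNgt Sy.
have : inf T <= y by apply: ge_inf; [exact: hT.2|split=> //; exact: ltW].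
by rewrite leNgt yT.
Qed.

(** Otherwise the increasing iterates of [x] are bounded by [t], and their supremum is a fixed point
    between [x] and [b]. *)
Lemma iter_pass f x b t : x < act f x ->
  (forall y, x < y -> y < b -> act f y <> y) -> t < b ->
  exists n, t < act (f ^+ n)%g x.
Proof.
move=> xf nofix tb; apply: contrapT => /forallNP N.
have {}N n : act (f ^+ n)%g x <= t by rewrite leNgt; apply/negP.
pose S := [set act (f ^+ n)%g x | n in [set: nat]].
have Sne : S !=set0 by exists (act (f ^+ 0)%g x); exists 0%N.
have hS : has_sup S by split=> //; exists t => _ [n _ <-].
have inS n : act (f ^+ n)%g x <= sup S by apply: sup_upper_bound => //; exists n.
have St : sup S <= t by apply: ge_sup => // _ [n _ <-].
apply: (nofix (sup S)).
- by apply: lt_le_trans xf _; exact: (inS 1%N).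
- exact: le_lt_trans tb.
apply/eqP; rewrite eq_le -[X in X && _](act_le f^-1%g) actK.
apply/andP; split; apply: ge_sup => // _ [n _ <-].
  by rewrite -(act_le f) actVK -actXS.
apply: (le_trans (y := act (f ^+ n.+1)%g x)); last by rewrite actXS act_le.
by rewrite actXSr act_le ltW.
Qed.

Lemma fix_between f x y : x < y -> x < act f x -> act f y < y ->
  exists2 z, x < z < y & act f z = z.
Proof.
move=> xy xf fy; apply: contrapT => N.
have fyn n : act (f ^+ n)%g y <= y.
  elim: n => [|n IH]; first by rewrite act1.
  by rewrite actXS (le_trans _ (ltW fy)) // act_le.
(* Passing [x] excludes exponent 0; passing [act f y] contradicts that all iterates of [x] stay
   below [y]. *)
have [||[|n]] := @iter_pass f x y (Num.max x (act f y)) xf.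
- by move=> z xz zy fz; apply: N; exists z; rewrite ?xz.
- by rewrite gt_max xy.
- by rewrite act1 gt_max ltxx.
rewrite gt_max actXS => /andP[_]; rewrite act_lt ltNge => /negP; apply.
by apply: le_trans (fyn n); rewrite act_le ltW.
Qed.

Lemma orbital_sign f a b x y : orbital f a b -> a < x -> x < b -> a < y ->
  y < b -> x < act f x -> y < act f y.
Proof.
move=> [ab fa fb nf] ax xb ay yb xf; rewrite ltNge; apply/negP => fy.
have {}fy : act f y < y by rewrite lt_neqAle fy andbT; apply/eqP; exact: nf.
have [xy|yx|e] := ltgtP x y; last by move: xf fy; rewrite e => /lt_trans h /h; rewrite ltxx.
  have [z /andP[xz zy]] := fix_between xy xf fy.
  by apply: nf; [exact: lt_trans xz|exact: lt_trans yb].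
have [||z /andP[yz zx] fz] := @fix_between f^-1%g y x yx.
- by rewrite act_ltV.
- by rewrite actV_lt.
apply: (nf z); [exact: lt_trans yz|exact: lt_trans xb|].
by rewrite -{1}fz actVK.
Qed.

Lemma orbital_inv f a b : orbital f a b -> orbital f^-1%g a b.
Proof.
move=> [ab fa fb nf]; split=> //; try exact: act_fixV.
by move=> x ax xb fx; apply: (nf x) => //; rewrite -{1}fx actVK.
Qed.

Lemma moves_up H f x : subgroup H -> H f -> act f x <> x ->
  exists2 f', H f' & x < act f' x.
Proof.
move=> /subgroupP[_ _ HV] Hf fx; have [xf|fx'|e] := ltgtP x (act f x).
- by exists f.
- by exists f^-1%g; [exact: HV|rewrite act_ltV].
- by case: fx.
Qed.

Lemma orbital_up H f a b : subgroup H -> H f -> orbital f a b ->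
  exists f', [/\ H f', orbital f' a b & forall x, a < x -> x < b -> x < act f' x].
Proof.
move=> sH Hf of_; have [ab _ _ nf] := of_.
have [ac cb] : a < (a + b) / 2 /\ (a + b) / 2 < b by split; lra.
have [xf|fx|e] := ltgtP ((a + b) / 2) (act f ((a + b) / 2)).
- exists f; split=> // x ax xb; exact: (orbital_sign of_ ac cb).
- have /subgroupP[_ _ HV] := sH.
  exists f^-1%g; split; [exact: HV|exact: orbital_inv|] => x ax xb.
  by apply: (orbital_sign (orbital_inv of_) ac cb); rewrite // act_ltV.
- by case: (nf _ ac cb).
Qed.

Lemma orbital_conj f g a b : orbital f a b ->
  orbital (g * f * g^-1)%g (act g a) (act g b).
Proof.
move=> [ab fa fb nf]; split; rewrite ?act_lt ?actM ?actK ?fa ?fb //.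
move=> x ax xb; rewrite !actM => e; apply: (nf (act g^-1%g x)).
- by rewrite act_ltV.
- by rewrite actV_lt.
- by apply: (@act_inj g); rewrite e actVK.
Qed.

Lemma orbital_in f a b x : orbital f a b -> a < x -> x < b ->
  a < act f x /\ act f x < b.
Proof. by move=> [ab fa fb _] ax xb; split; [rewrite -fa|rewrite -fb]; rewrite act_lt. Qed.

(** To the right of a common fixed point both maps are homotheties centred there, and these
    commute. *)
Lemma germ_right f g a : act f a = a -> act g a = a ->
  exists2 v, a < v & forall x, a <= x -> x <= v ->
    act f (act g x) = act g (act f x).
Proof.
move=> fa ga; have [Bf FB] := pl_affine actP f; have [Bg GB] := pl_affine actP g.
have [v av [al [be E]]] := affine_off_right a FB.
have [w aw [al' [be' E']]] := affine_off_right a GB.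
(* Below [m], the points [x], [act g x] and [act f x] all lie in the affine pieces needed. *)
pose m := Num.min (Num.min v w) (Num.min (act g^-1%g v) (act f^-1%g w)).
exists m.
  by rewrite !lt_min av aw !act_ltV fa ga av.
move=> x ax; rewrite !le_min => /andP[/andP[xv xw] /andP[gv' fw']].
have gv : act g x <= v by rewrite -(actVK g v) act_le.
have fw : act f x <= w by rewrite -(actVK f w) act_le.
have ea : a = al * a + be by rewrite -[LHS]fa E // lexx ltW.
have ea' : a = al' * a + be' by rewrite -[LHS]ga E' // lexx ltW.
have ag : a <= act g x by rewrite -ga act_le.
have af : a <= act f x by rewrite -fa act_le.
rewrite (E (act g x)) ?ag // (E' (act f x)) ?af // E ?ax // E' ?ax //.
have -> : be = a - al * a by lra.
have -> : be' = a - al' * a by lra.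
by rewrite !mulrDr !mulrN !mulrA [al' * al]mulrC; lra.
Qed.

End PLActions.

Section Mirror.
Variables (R : realType) (G : groupType) (act : G -> R -> R).
Hypothesis actP : pl_action act.

Lemma mirror_orbital f a b : orbital act f a b -> orbital (mirror act) f (- b) (- a).
Proof.
rewrite /mirror; move=> [ab fa fb nf]; split; rewrite ?opprK ?fa ?fb ?ltrN2 //.
by move=> x bx xa e; apply: (nf (- x)); lra.
Qed.

Lemma germ_left f g b : act f b = b -> act g b = b ->
  exists2 u, u < b & forall x, u <= x -> x <= b ->
    act f (act g x) = act g (act f x).
Proof.
move=> fb gb; have [||v bv vE] := @germ_right _ _ _ (mirror_pl_action actP) f g (- b).
- by rewrite /mirror opprK fb.
- by rewrite /mirror opprK gb.
exists (- v); first lra.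
move=> x vx xb; have := vE (- x); rewrite /mirror !opprK => h.
by apply: oppr_inj; apply: h; lra.
Qed.

End Mirror.

(** * Crossing orbitals *)

Section CommutingPoints.
Variables (R : realType) (G : groupType) (act : G -> R -> R).
Hypothesis actP : pl_action act.
Implicit Types (f g h k : G) (H K : set G).

(** Equivalently, [z] is fixed by the derived subgroup of [K]. *)
Definition commuting_point K z : Prop :=
  forall u v, K u -> K v -> act u (act v z) = act v (act u z).

Lemma act_commg u v z :
  act [~ u, v]%g z = z <-> act u (act v z) = act v (act u z).
Proof.
have -> : [~ u, v]%g = ((v * u)^-1 * (u * v))%g.
  by rewrite /commg /conjg invgM !mulgA.
rewrite !(pl_mul actP); split=> [e|->]; last by rewrite -(pl_mul actP v) actK.
apply: (act_inj actP (f := (v * u)^-1%g)); rewrite e -(pl_mul actP v) actK //.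
Qed.

Lemma commuting_point_act K z w : subgroup K -> K w ->
  commuting_point K z -> commuting_point K (act w z).
Proof.
move=> /subgroupP[_ KM _] Kw cz u v Ku Kv.
rewrite -(pl_mul actP v) (cz _ _ Ku (KM _ _ Kv Kw)) (pl_mul actP).
by rewrite (cz u w).
Qed.

(** The iterates of [z] under [k] are commuting points increasing to [y]; a commutator fixes them
    all, hence also their limit. *)
Lemma commuting_point_limit K k z y : K k -> z < y -> z < act k z ->
  act k y = y -> (forall t, z < t -> t < y -> act k t <> t) ->
  commuting_point K z -> subgroup K -> commuting_point K y.
Proof.
move=> Kk zy zk ky nf cz sK u v Ku Kv; apply/act_commg.
have ckz n : commuting_point K (act (k ^+ n)%g z).
  elim: n => [|n IH]; first by rewrite pl_1.
  by rewrite actXS //; exact: commuting_point_act.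
have aux m : (forall n, act m (act (k ^+ n)%g z) = act (k ^+ n)%g z) -> y <= act m y.
  move=> mk; rewrite leNgt; apply/negP => my.
  have [n] := iter_pass actP zk nf my.
  by rewrite -mk act_lt // ltNge -{1}(act_fixX actP n ky) act_le // ltW.
have fixC n : act [~ u, v]%g (act (k ^+ n)%g z) = act (k ^+ n)%g z.
  by apply/act_commg; exact: ckz.
apply/eqP; rewrite eq_le aux // andbT -(act_le actP [~ u, v]^-1%g) actK //.
by apply: aux => n; exact: act_fixV.
Qed.

Lemma crossing_commuting K g h a b c d z : subgroup K -> K g -> K h ->
  orbital act g a b -> orbital act h c d -> a < c -> c < b -> b < d ->
  a < z -> z < b -> ~ commuting_point K z.
Proof.
move=> sK Kg Kh og oh ac cb bd az zb cz.
have [g' [Kg' og' gup]] := orbital_up actP sK Kg og.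
have [h' [Kh' oh' hup]] := orbital_up actP sK Kh oh.
have [ab _ gb nf] := og'.
have cb' : commuting_point K b.
  apply: (commuting_point_limit Kg' zb) => //; first exact: gup.
  by move=> t zt tb; apply: nf => //; exact: lt_trans zt.
have hb : act h'^-1%g b < b by rewrite actV_lt //; exact: hup.
have [ch _] := orbital_in actP (orbital_inv actP oh') cb bd.
apply: (nf (act h'^-1%g b)) => //; first exact: lt_trans ch.
have /subgroupP[_ _ KV] := sK.
by rewrite cb' ?gb //; exact: KV.
Qed.

(* If [z] were a commuting point, then an element [k] moving [z] and an element
   [w] moving the right end [y] of the orbital of [k] at [z] would yield a
   strictly monotone sequence [w^n y < w^n+1 z < w^n+1 y < ...] of points that [k]
   alternately fixes and moves, converging to a fixed point of [w]: impossible
   for a function with finitely many breakpoints. *)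
Lemma moving_not_commuting K a q : subgroup K ->
  (forall z, a < z -> z < q -> exists2 k, K k & act k z <> z) ->
  (forall k, K k -> exists2 r, r < q & forall x, r <= x -> x <= q -> act k x = x) ->
  forall z, a < z -> z < q -> ~ commuting_point K z.
Proof.
move=> sK mv nearq z az zq cz.
have /subgroupP[_ KM KV] := sK.
have [k0 Kk0 k0z] := mv z az zq.
have [k Kk zk] := moves_up actP sK Kk0 k0z.
have kz : act k z <> z by move=> e; rewrite e ltxx in zk.
have [x [y [xz zy ok]]] := orbital_ex actP kz.
have [xy _ ky nf] := ok.
have yq : y < q.
  have [r rq rE] := nearq k Kk; rewrite ltNge; apply/negP => qy.
  pose t := Num.max r ((z + q) / 2).
  have tq : t < q by rewrite gt_max rq; lra.
  have rt : r <= t by rewrite le_max lexx.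
  have zt : z < t by rewrite lt_max; apply/orP; right; lra.
  by apply: (nf t); [lra|lra|apply: rE => //; exact: ltW].
have cy : commuting_point K y.
  by apply: (commuting_point_limit Kk zy) => // t zt ty; apply: nf => //; exact: lt_trans zt.
have [w0 Kw0 w0y] := mv y (lt_trans az zy) yq.
have [w Kw yw] := moves_up actP sK Kw0 w0y.
have wy : act w y <> y by move=> e; rewrite e ltxx in yw.
have [x' [y' [xy' yy' [_ _ wy' nf']]]] := orbital_ex actP wy.
(* As [y] is a commuting point fixed by [k], so is [act w^-1 y]; it therefore cannot lie in
   [[z, y)], inside the orbital of [k]. *)
have Vz : act w^-1%g y < z.
  rewrite ltNge; apply/negP => zV; apply: (nf (act w^-1%g y)).
  - exact: lt_le_trans zV.
  - by rewrite actV_lt.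
  by rewrite cy ?ky //; exact: KV.
have [B kB] := pl_affine actP k.
have [u uy' [al [be E]]] := affine_off_left y' kB.
have [|n un] := iter_pass actP yw _ uy'.
  by move=> t yt ty; apply: nf' => //; exact: lt_trans yt.
have KX m : K (w ^+ m)%g by elim: m => [|m IH]; [have /subgroupP[] := sK|rewrite expgS; exact: KM].
have fixk m : act k (act (w ^+ m)%g y) = act (w ^+ m)%g y by rewrite cy ?ky.
have lt1 : act (w ^+ n)%g y < act (w ^+ n.+1)%g z.
  by rewrite actXSr // act_lt // -actV_lt.
have lt2 : act (w ^+ n.+1)%g z < act (w ^+ n.+1)%g y by rewrite act_lt.
have lt3 : act (w ^+ n.+1)%g y <= y'.
  by rewrite -(act_fixX actP n.+1 wy') act_le // ltW.
have kaff : affine_itv (act k) u y' by exists al, be.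
(* On [[u, y']] the affine map [k] fixes two points, hence is the identity there, yet it moves
   [w^(n+1) z] between them. *)
have idaff : affine_itv (act 1%g) u y' by exists 1, 0 => t _; rewrite pl_1 // mul1r addr0.
have := @affine_eq2 _ _ _ u y' (act (w ^+ n)%g y) (act (w ^+ n.+1)%g y) kaff idaff.
move=> /(_ (ltW un) (lt_trans lt1 lt2) lt3); rewrite !fixk !pl_1 // => /(_ erefl erefl).
move=> /(_ (act (w ^+ n.+1)%g z)) h.
have : act k (act (w ^+ n.+1)%g z) = act (w ^+ n.+1)%g z.
  by rewrite h ?pl_1 //; apply/andP; split; lra.
by rewrite cz // => /(act_inj actP) /kz.
Qed.

Lemma derived_moves K z : ~ commuting_point K z ->
  exists2 k, derived_subgroup K k & act k z <> z.
Proof.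
move=> nc; apply: contrapT => N; apply: nc => u v Ku Kv.
apply/act_commg; apply: contrapT => m; apply: N; exists [~ u, v]%g => //.
by apply: sub_generated; exists u => //; exists v.
Qed.

(** Germs at the common fixed point [q] commute, so commutators are the identity just left of [q];
    products and inverses inherit this. *)
Lemma derived_near_end K q : (forall k, K k -> act k q = q) ->
  forall k, derived_subgroup K k ->
    exists2 r, r < q & forall x, r <= x -> x <= q -> act k x = x.
Proof.
move=> Kq; apply: generated_min.
  apply/subgroupP; split.
  - by exists (q - 1) => [|x _ _]; [lra|rewrite pl_1].
  - move=> f g [r rq rE] [r' rq' rE']; exists (Num.max r r'); first by rewrite gt_max rq.
    by move=> x; rewrite ge_max => /andP[h1 h2] xq; rewrite (pl_mul actP) rE' ?rE.
  - by move=> f [r rq rE]; exists r => // x rx xq; apply: act_fixV => //; exact: rE.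
move=> _ [u Ku [v Kv <-]].
have [r rq rE] := germ_left actP (Kq _ Ku) (Kq _ Kv).
by exists r => // x rx xq; apply/act_commg; exact: rE.
Qed.

End CommutingPoints.

Section Crossings.
Variables (R : realType) (G : groupType) (act : G -> R -> R).
Hypothesis actP : pl_action act.
Implicit Types (f g h k : G) (H K : set G).

Lemma mirror_commuting K z : commuting_point act K z ->
  commuting_point (mirror act) K (- z).
Proof. by move=> cz u v Ku Kv; rewrite /mirror !opprK cz. Qed.

Lemma crossing_not_solvable g h a b c d :
  orbital act g a b -> orbital act h c d -> a < c -> c < b -> b < d ->
  ~ solvable_subgroup (generated [set g; h]).
Proof.
move=> og oh ac cb bd [n].
set K := generated _ => Kn.
have sK : subgroup K by exact: generated_subgroup.
have Kg : K g by apply: sub_generated; left.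
have Kh : K h by apply: sub_generated; right.
have noc z : a < z -> z < d -> ~ commuting_point act K z.
  move=> az zd; have [zb|bz] := ltP z b.
    exact: (crossing_commuting actP sK Kg Kh og oh).
  (* For [z] in [[b, d)], reflection exchanges the roles of [g] and [h]. *)
  move=> /mirror_commuting.
  by apply: (crossing_commuting (mirror_pl_action actP) sK Kh Kg
    (mirror_orbital oh) (mirror_orbital og)); lra.
have [m [M bdd]] := pl_bounded actP.
pose T := [set z | d <= z /\ commuting_point act K z].
have T0 : T !=set0.
  exists (Num.max d M); split; first by rewrite le_max lexx.
  by move=> u v _ _; rewrite !bdd // le_max lexx orbT; right.
have hT : has_inf T by split=> //; exists d => z [].
pose q := inf T.
have dq : d <= q by apply: lb_le_inf => // z [].
have cq : commuting_point act K q.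
  move=> u v Ku Kv; apply/(act_commg actP); apply: (fix_inf actP) => // z [_ cz].
  by apply/(act_commg actP); exact: cz.
have nocq z : a < z -> z < q -> ~ commuting_point act K z.
  move=> az zq cz; have [zd|dz] := ltP z d; first exact: (noc z).
  have : q <= z by apply: ge_inf; [exact: hT.2|].
  by rewrite leNgt zq.
(* Fixing a point of [(a, d]] keeps the image of [q] above [a]; this image is a commuting point, and
   none lies in [(a, q)]. Both generators fix such a point, [b] or [d], so [K] fixes [q]. *)
have qle k x : K k -> a < x -> x <= d -> act k x = x -> q <= act k q.
  move=> Kk ax xd kx; have aq : a < act k q.
    by apply: (lt_le_trans ax); rewrite -kx act_le // (le_trans xd).
  rewrite leNgt; apply/negP => qk; apply: (nocq _ aq qk).
  exact: commuting_point_act.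
have /subgroupP[_ KM KV] := sK.
have qfix k x : K k -> a < x -> x <= d -> act k x = x -> act k q = q.
  move=> Kk ax xd kx; apply/eqP; rewrite eq_le (qle k x) // andbT.
  rewrite -(act_le actP k^-1%g) actK //; apply: (qle _ x) => //; first exact: KV.
  exact: act_fixV.
have Kq k : K k -> act k q = q.
  have sQ : subgroup [set k | act k q = q].
    apply/subgroupP; split=> /=; first exact: pl_1.
    - by move=> f f' fq fq'; rewrite (pl_mul actP) fq' fq.
    - by move=> f; exact: act_fixV.
  apply: (generated_min sQ) => _ [->|->] /=.
    by have [_ _ gb _] := og; apply: (qfix _ b) => //; lra.
  by have [_ _ hd _] := oh; apply: (qfix _ d) => //; lra.
have D1 := derived_near_end actP Kq.
(* The index starts at 1: being the identity near [q] is known from the first derived subgroup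
   on. *)
have Dn i : [/\ subgroup (derived_series i.+1 K),
    derived_series i.+1 K `<=` derived_subgroup K &
    forall z, a < z -> z < q -> exists2 k, derived_series i.+1 K k & act k z <> z].
  elim: i => [|i [sD DD mD]]; split=> //.
  - exact: generated_subgroup.
  - by move=> z az zq; apply: (derived_moves actP); exact: nocq.
  - exact: generated_subgroup.
  - by apply: subset_trans DD; exact: derived_sub.
  - move=> z az zq; apply: (derived_moves actP).
    by apply: (moving_not_commuting actP sD mD) az zq => k /DD/D1.
have [_ _ mD] := Dn n.
have [||k Dk] := mD ((a + d) / 2); [lra|lra|].
have Dk' : derived_series n K k.
  case: n Kn Dk {mD} => [|n'] Kn Dk; first exact: (derived_sub sK).
  by apply: (derived_sub (H := derived_series n'.+1 K)) => //; have [] := Dn n'.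
by rewrite Kn in Dk'; rewrite Dk' pl_1.
Qed.

Lemma locally_solvable_no_crossing H g h a b c d : subgroup H ->
  locally_solvable H -> H g -> H h ->
  orbital act g a b -> orbital act h c d -> a < c -> c < b -> b < d -> False.
Proof.
move=> sH lH Hg Hh og oh ac cb bd.
apply: (crossing_not_solvable og oh ac cb bd); apply: lH.
- exact: generated_subgroup.
- by apply: generated_min => // _ [->|->].
- by exists [set g; h] => //; exact: finite_set2.
Qed.

End Crossings.

(** * Countability by means of codes *)

Section CountableCodes.

(** [P] is a relation, so any rational or breakpoint at hand may serve as a code; a coding function
    is chosen inside the proof. *)
Lemma countable_code (T U : Type) (S : set T) (D : set U) (P : T -> U -> Prop) :
  countable D -> (forall x, S x -> exists2 d, D d & P x d) ->
  (forall x y d, S x -> S y -> P x d -> P y d -> x = y) -> countable S.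
Proof.
move=> /countable_injP[f finj] SP inj.
have /choice[F FP] x : exists n, S x -> exists d, [/\ D d, P x d & f d = n].
  have [Sx|nSx] := pselect (S x); last by exists 0%N.
  by have [d Dd Pd] := SP x Sx; exists (f d) => _; exists d.
apply/countable_injP; exists F => x y /set_mem Sx /set_mem Sy e.
have [d [Dd Pd fd]] := FP x Sx; have [d' [Dd' Pd' fd']] := FP y Sy.
have dd : d = d' by apply: finj; rewrite ?inE // fd fd'.
by apply: (inj x y d) => //; rewrite dd.
Qed.

Lemma countable_subset (T : Type) (A B : set T) :
  A `<=` B -> countable B -> countable A.
Proof. by move=> /subset_card_le; exact: sub_countable. Qed.

Lemma countable_img (T U : Type) (A : set T) (f : T -> U) :
  countable A -> countable (f @` A).
Proof.
move=> cA; apply: (countable_code (P := fun y x => f x = y) cA).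
  by move=> _ [x Ax <-]; exists x.
by move=> x y d _ _ -> ->.
Qed.

End CountableCodes.

(** * Families of orbitals without crossings *)

Section LaminarOrbitals.
Variables (R : realType) (G : groupType).
Implicit Types (act : G -> R -> R) (f g h k : G) (H K : set G).

(** All that the countability argument uses of local solvability. *)
Definition no_crossing act H : Prop := forall g h a b c d, H g -> H h ->
  orbital act g a b -> orbital act h c d -> a < c -> c < b -> b < d -> False.

Lemma mirrorK act : mirror (mirror act) = act.
Proof. by apply/funext => f; apply/funext => x; rewrite /mirror !opprK. Qed.

Lemma mirror_no_crossing act H : no_crossing act H -> no_crossing (mirror act) H.
Proof.
move=> nc g h a b c d Hg Hh /mirror_orbital + /mirror_orbital.
rewrite mirrorK => og oh ac cb bd.
by apply: (nc _ _ _ _ _ _ Hh Hg oh og); lra.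
Qed.

(* [[g, h]] is the identity near [a], so the conjugate by [h] of one of its orbitals
   contains [b] but not [a], and crosses the orbital of [g]. *)
Lemma balanced_left act H g h a b d : pl_action act -> subgroup H ->
  no_crossing act H -> H g -> H h ->
  orbital act g a b -> orbital act h a d -> b < d -> False.
Proof.
move=> actP sH nc Hg Hh og oh bd.
have [h' [Hh' oh' hup]] := orbital_up actP sH Hh oh.
have /subgroupP[_ HM HV] := sH.
have [ab ga gb nf] := og; have [ad ha hd nf'] := oh'.
have [v av vE] := germ_right actP ga ha.
pose k := [~ g, h']%g; pose e := act h'^-1%g b.
have eb : e < b by rewrite actV_lt //; exact: hup.
have [ae _] := orbital_in actP (orbital_inv actP oh') ab bd.
(* Since [h'] maps [e] to [b], which [g] fixes, commuting at [e] would make [g] fix [e]. *)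
have ke : act k e <> e.
  move/(act_commg actP); rewrite /e actVK // gb => he.
  by apply: (nf e) => //; rewrite -(actK actP h' (act g e)) -he.
have [x [y [xe ey ok]]] := orbital_ex actP ke.
have kv : act k v = v by apply/(act_commg actP); apply: vE => //; exact: ltW.
have ve : v < e.
  rewrite ltNge; apply/negP => ev; apply: ke; apply/(act_commg actP).
  by apply: vE => //; exact: ltW.
have vx : v <= x.
  rewrite leNgt; apply/negP => xv; have [_ _ _ /(_ v xv)] := ok.
  by move=> /(_ (lt_trans ve ey)).
(* The conjugated orbital satisfies [a < act h' x < b < act h' y], because [x < e < y]. *)
apply: (nc _ _ _ _ _ _ Hg _ og (orbital_conj actP h' ok)).
- by apply: (HM _ _ _ (HV _ Hh')); apply: (HM _ _ Hh'); apply: (derived_sub sH);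
    apply: sub_generated; exists g => //; exists h'.
- by rewrite -ha act_lt //; exact: lt_le_trans vx.
- by rewrite -(actVK actP h' b) act_lt.
- by rewrite -(actVK actP h' b) act_lt.
Qed.

Variables (act : G -> R -> R) (H : set G).
Hypotheses (actP : pl_action act) (sH : subgroup H) (nc : no_crossing act H).

Lemma balanced_right g h a b c : H g -> H h ->
  orbital act g a b -> orbital act h c b -> c < a -> False.
Proof.
move=> Hg Hh og oh ca.
apply: (balanced_left (mirror_pl_action actP) sH (mirror_no_crossing nc) Hg Hh
  (mirror_orbital og) (mirror_orbital oh)).
by rewrite ltrN2.
Qed.

(** Of the nine comparisons of endpoints, [nc] excludes the two crossings, and the balanced lemmas
    the four with exactly one common endpoint. *)
Lemma orbital_trichotomy g h a b c d : H g -> H h ->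
  orbital act g a b -> orbital act h c d -> a < d -> c < b ->
  [\/ a = c /\ b = d, a < c /\ d < b | c < a /\ b < d].
Proof.
move=> Hg Hh og oh ad cb.
have [ac|ca|e] := ltgtP a c; have [bd|db|e'] := ltgtP b d.
- by case: (nc Hg Hh og oh).
- by constructor 2.
- by rewrite e' in og cb; case: (balanced_right Hh Hg oh og).
- by constructor 3.
- by case: (nc Hh Hg oh og).
- by rewrite e' in og cb; case: (balanced_right Hg Hh og oh).
- by rewrite e in og; case: (balanced_left actP sH nc Hg Hh og oh).
- by rewrite e in og; case: (balanced_left actP sH nc Hh Hg oh og).
- by constructor 1.
Qed.

(** Otherwise [(c, d)] crosses its image under [f], an orbital of the conjugate of [k]. *)
Lemma orbital_jump f k a b c d : H f -> H k ->
  orbital act f a b -> (forall x, a < x -> x < b -> x < act f x) ->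
  orbital act k c d -> a < c -> d < b -> d <= act f c.
Proof.
move=> Hf Hk of_ fup ok ac db; rewrite leNgt; apply/negP => fcd.
have [cd _ _ _] := ok; have /subgroupP[_ HM HV] := sH.
apply: (nc Hk _ ok (orbital_conj actP f ok)) => //.
- exact: HM (HM _ _ Hf Hk) (HV _ Hf).
- by apply: fup => //; exact: lt_trans db.
- by apply: fup => //; exact: lt_trans cd.
Qed.

Definition orbitals : set (R * R) :=
  [set p | exists2 g, H g & orbital act g p.1 p.2].

(* An orbital [(a, b)] of [f] containing [q] is recovered from [q] and any [r] in
   [(f q, b)]: a smaller orbital containing [q] ends before [f q]. *)
Lemma orbitals_countable : countable orbitals.
Proof.
pose P (p : R * R) (c : rat * rat) := let q := ratr c.1 in let r := ratr c.2 in
  [/\ p.1 < q, q < p.2 & exists f, [/\ H f, orbital act f p.1 p.2,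
    forall x, p.1 < x -> x < p.2 -> x < act f x, act f q < r & r < p.2]].
apply: (@countable_code _ _ _ setT P); first exact: countableP.
  move=> [a b] [g Hg og] /=.
  have [f [Hf of_ fup]] := orbital_up actP sH Hg og; have [ab _ _ _] := of_.
  have [q] := rat_in_itvoo ab; rewrite in_itv /= => /andP[aq qb].
  have [_ fqb] := orbital_in actP of_ aq qb.
  have [r] := rat_in_itvoo fqb; rewrite in_itv /= => /andP[fr rb].
  by exists (q, r) => //; split=> //; exists f.
have aux (p p' : R * R) c : P p c -> P p' c -> p.1 < p'.1 -> p'.2 < p.2 -> False.
  move=> [aq qb [f [Hf of_ fup fr rb]]] [aq' qb' [k [Hk ok _ _ rb']]] aa' bb'.
  have := orbital_jump Hf Hk of_ fup ok aa' bb'.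
  apply/negP; rewrite -ltNge; apply: (lt_trans _ rb'); apply: (lt_trans _ fr).
  by rewrite act_lt.
move=> [a b] [a' b'] c _ _ Pc Pc'.
have [/= aq qb [f [Hf of_ _ _ _]]] := Pc; have [/= aq' qb' [f' [Hf' of_' _ _ _]]] := Pc'.
have [[-> ->//]|[aa bb]|[aa bb]] := orbital_trichotomy Hf Hf' of_ of_'
  (lt_trans aq qb') (lt_trans aq' qb).
- by case: (aux _ _ _ Pc Pc').
- by case: (aux _ _ _ Pc' Pc).
Qed.

Definition endpoints : set R := [set x | exists2 p, orbitals p & x = p.1 \/ x = p.2].

Lemma endpoints_countable : countable endpoints.
Proof.
have cO := orbitals_countable.
apply: (countable_subset (B := \bigcup_(i in [set: bool])
  ((if i then fst else snd) @` orbitals))).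
  by move=> x [p Op [->|->]]; [exists true|exists false] => //; exists p.
by apply: bigcup_countable => // i _; exact: countable_img.
Qed.

Lemma orbitals_act g p : H g -> orbitals p -> orbitals (act g p.1, act g p.2).
Proof.
move=> Hg [f Hf of_]; have /subgroupP[_ HM HV] := sH.
by exists (g * f * g^-1)%g; [exact: HM (HM _ _ Hg Hf) (HV _ Hg)|exact: orbital_conj].
Qed.

Lemma endpoints_act g x : H g -> endpoints x -> endpoints (act g x).
Proof.
move=> Hg [p Op px]; exists (act g p.1, act g p.2); first exact: orbitals_act.
by case: px => ->; [left|right].
Qed.

Lemma endpoints_orbital f a b : H f -> orbital act f a b -> endpoints a /\ endpoints b.
Proof. by move=> Hf of_; split; exists (a, b); (try by exists f); [left|right]. Qed.

End LaminarOrbitals.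

(** * Free actions on an orbital *)

Section LocallyAffineActions.
Variables (R : realType) (G : groupType) (act : G -> R -> R).
Hypothesis actP : pl_action act.
Implicit Types (f g : G).

Lemma locally_affine_mul f g x : locally_affine (act g) x ->
  locally_affine (act f) (act g x) -> locally_affine (act (f * g)%g) x.
Proof.
move=> [u [v [ux xv [al [be E]]]]] [u' [v' [ux' xv' [al' [be' E']]]]].
exists (Num.max u (act g^-1%g u')), (Num.min v (act g^-1%g v')); split.
- by rewrite gt_max ux actV_lt.
- by rewrite lt_min xv act_ltV.
exists (al' * al), (al' * be + be') => t.
rewrite ge_max le_min => /andP[/andP[ut ut'] /andP[tv tv']].
rewrite (pl_mul actP) E'; first by rewrite E ?ut // mulrDr mulrA addrA.
by apply/andP; split; [rewrite -(actVK actP g u')|rewrite -(actVK actP g v')]; rewrite act_le.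
Qed.

Lemma locally_affine_inv f x : locally_affine (act f) x ->
  locally_affine (act f^-1%g) (act f x).
Proof.
move=> [u [v [ux xv [al [be E]]]]].
exists (act f u), (act f v); rewrite !act_lt //; split=> //.
have uv : u < v by exact: lt_trans xv.
have al0 : al != 0.
  apply/eqP => al0; have := pl_lt actP f uv.
  by rewrite !E ?lexx ?(ltW uv) // al0 !mul0r ltxx.
exists al^-1, (- (al^-1 * be)) => y /andP[uy yv].
rewrite -{2}(actVK actP f y) (E (act f^-1%g y)).
  by rewrite mulrDr mulKf // addrK.
by apply/andP; split; [rewrite -(act_le actP f)|rewrite -(act_le actP f)]; rewrite actVK.
Qed.

Lemma locally_affine_pl_countable f : countable [set x | ~ locally_affine (act f) x].
Proof.
have [B fB] := pl_affine actP f.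
apply: (countable_subset (B := [set` B])); last exact/finite_set_countable/finite_seq.
by move=> x nl; apply: contrapT => /negP xB; apply: nl; exact: affine_off_notin xB.
Qed.

(* [F] conjugates [f] near [a], of slope [al > 1], to [f] near [b], of slope [be < 1]. *)
Lemma commuting_not_affine f F a b x x1 y1 : orbital act f a b ->
  (forall t, a < t -> t < b -> t < act f t) ->
  affine_itv (act f) a x1 -> affine_itv (act f) y1 b ->
  (forall t, a < t -> t < b -> act F (act f t) = act f (act F t)) ->
  a < x -> act f x <= x1 -> x1 < b -> y1 <= act F x -> a < act F x -> act F x < b ->
  ~ affine_itv (act F) x (act f (act f x)).
Proof.
move=> of_ fup [al [ga E]] [be [de E']] com ax fx1 x1b yF aF Fb [mu [nu EF]].
have [ab fa fb nf] := of_.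
have fxb : act f x < b by exact: le_lt_trans x1b.
have xb : x < b by rewrite -(act_lt actP f) fb.
have xf := fup _ ax xb.
have ff := fup _ (lt_trans ax xf) fxb.
have Ff := fup _ aF Fb.
have [_ fFb] := orbital_in actP of_ aF Fb.
have e0 : a = al * a + ga by rewrite -E ?fa // lexx (le_trans _ fx1) // ltW // (lt_trans ax).
have e1 : act f x = al * x + ga by rewrite E // (ltW ax) (le_trans _ fx1) // ltW.
have e2 : act f (act f x) = al * act f x + ga by rewrite E // fx1 andbT ltW // (lt_trans ax).
have d0 : b = be * b + de by rewrite -E' ?fb // lexx andbT (le_trans yF) // ltW.
have d1 : act f (act F x) = be * act F x + de by rewrite E' // yF ltW.
have d2 : act f (act f (act F x)) = be * act f (act F x) + de.
  by rewrite E' // (ltW fFb) andbT (le_trans yF) // ltW.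
have c0 : act F x = mu * x + nu by rewrite EF // lexx ltW // (lt_trans xf).
have c1 : act f (act F x) = mu * act f x + nu by rewrite -com // EF // !ltW.
have c2 : act f (act f (act F x)) = mu * act f (act f x) + nu.
  by rewrite -!com ?EF ?lexx ?andbT ?(ltW (lt_trans xf ff)) //; exact: lt_trans xf.
set X := act f x in e1 e2 c1 c2 xf ff fx1 fxb *.
set Z := act F x in c0 c1 c2 d1 d2 aF Fb Ff fFb yF *.
set W := act f Z in c1 c2 d1 d2 Ff fFb *.
rewrite e2 in c2; have al1 : 1 < al by nra.
have be1 : be < 1 by nra.
(* [F] multiplies the lengths of [[x, X]] and [[X, act f X]] by [mu]; their ratio is [al], that of
   the image lengths is [be]. *)
have : (al - be) * (W - Z) = 0.
  have -> : (al - be) * (W - Z) = al * (W - Z) - be * (W - Z) by lra.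
  have -> : be * (W - Z) = mu * (al * X + ga - X) by lra.
  have -> : W - Z = mu * (X - x) by lra.
  have -> : al * X + ga - X = al * (X - x) by lra.
  by rewrite mulrCA subrr.
by move/eqP; rewrite mulf_eq0 => /orP[/eqP|/eqP]; lra.
Qed.

End LocallyAffineActions.

Section FreeOrbital.
Variables (R : realType) (G : groupType) (act : G -> R -> R) (H : set G).
Hypotheses (actP : pl_action act) (sH : subgroup H).
Variables (f : G) (a b : R).
Hypotheses (Hf : H f) (of_ : orbital act f a b)
  (fup : forall t, a < t -> t < b -> t < act f t).

Definition itv_stabilizer : set G := [set s | [/\ H s, act s a = a & act s b = b]].

Hypothesis free : forall s x y, itv_stabilizer s -> a < x -> x < b ->
  act s x = x -> a < y -> y < b -> act s y = y.

Lemma itv_stabilizer_subgroup : subgroup itv_stabilizer.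
Proof.
have /subgroupP[H1 HM HV] := sH; apply/subgroupP; split.
- by split; rewrite ?pl_1.
- move=> s t [Hs sa sb] [Ht ta tb].
  by split; [exact: HM|rewrite (pl_mul actP) ta sa|rewrite (pl_mul actP) tb sb].
- by move=> s [Hs sa sb]; split; [exact: HV|exact: act_fixV|exact: act_fixV].
Qed.

(** The germs of [s] and [f] at [a] commute, so their commutator fixes a point of [(a, b)], and by
    freeness all of them. *)
Lemma itv_stabilizer_commutes s x : itv_stabilizer s -> a < x -> x < b ->
  act s (act f x) = act f (act s x).
Proof.
move=> Ss ax xb; have [ab fa fb _] := of_; have [Hs sa sb] := Ss.
have Sf : itv_stabilizer f by [].
have [v av vE] := germ_right actP sa fa.
have Sc : itv_stabilizer [~ s, f]%g.
  apply: (derived_sub itv_stabilizer_subgroup).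
  by apply: sub_generated; exists s => //; exists f.
apply/(act_commg actP).
pose y := Num.min v ((a + b) / 2).
have [ay yv yb] : [/\ a < y, y <= v & y < b].
  by rewrite /y lt_min av ge_min lexx gt_min; split=> //; [|apply/orP; right]; lra.
apply: (free (x := y)) => //.
by apply/(act_commg actP); apply: vE => //; exact: ltW.
Qed.

Definition power_breaks : set R := [set x | exists m, ~ locally_affine (act (f ^+ m)%g) x].

Lemma power_breaks_countable : countable power_breaks.
Proof.
apply: (countable_subset (B := \bigcup_(m in [set: nat])
  [set x | ~ locally_affine (act (f ^+ m)%g) x])).
  by move=> x [m xm]; exists m.
by apply: bigcup_countable => // m _; exact: locally_affine_pl_countable.
Qed.

(* [f^m] has a breakpoint [t] near [a] with [f^m t] near [b]; as [s] is affine near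
   [t] and [f^m t], the function [f^m = s f^m s^-1] breaks at [s t]. *)
Lemma power_breaks_moved s : itv_stabilizer s ->
  exists t, [/\ a < t, t < b, power_breaks t & power_breaks (act s t)].
Proof.
move=> Ss; have [ab fa fb nf] := of_; have [Hs sa sb] := Ss.
have [Bf fB] := pl_affine actP f; have [Bs sB] := pl_affine actP s.
have [vf avf fvf] := affine_off_right a fB; have [vs avs svs] := affine_off_right a sB.
have [wf wfb fwf] := affine_off_left b fB; have [ws wsb sws] := affine_off_left b sB.
pose c := (a + b) / 2; have [ac cb] : a < c /\ c < b by rewrite /c; split; lra.
(* Both [f] and [s] are affine on [[a, x1]] and on [[y1, b]]. *)
pose x1 := Num.min c (Num.min vf vs); pose y1 := Num.max c (Num.max wf ws).
have [ax1 x1c x1f x1s] : [/\ a < x1, x1 <= c, x1 <= vf & x1 <= vs].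
  by rewrite /x1 !lt_min !ge_min !lexx ac avf avs !orbT.
have [y1b cy1 y1f y1s] : [/\ y1 < b, c <= y1, wf <= y1 & ws <= y1].
  by rewrite /y1 !gt_max !le_max !lexx cb wfb wsb !orbT.
have x1b : x1 < b by exact: le_lt_trans cb.
have fX m t : a < t -> t < b -> a < act (f ^+ m)%g t /\ act (f ^+ m)%g t < b.
  move=> at_ tb; split; [rewrite -(act_fixX actP m fa)|rewrite -(act_fixX actP m fb)];
    by rewrite act_lt.
have comX m t : a < t -> t < b -> act s (act (f ^+ m)%g t) = act (f ^+ m)%g (act s t).
  move=> at_ tb; elim: m => [|m IH]; first by rewrite !pl_1.
  have [h1 h2] := fX m t at_ tb.
  by rewrite !actXS // itv_stabilizer_commutes // IH.
(* Pull [x1] back three times by [f]. *)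
have [x [ax xf ff ffx]] : exists x,
    [/\ a < x, x < act f x, act f x < act f (act f x) & act f (act f x) < x1].
  have dn t : a < t -> t < b -> a < act f^-1%g t < t.
    move=> at_ tb; have [h1 _] := orbital_in actP (orbital_inv actP of_) at_ tb.
    by rewrite h1 actV_lt // fup.
  have /andP[h1 h2] := dn _ ax1 x1b.
  have /andP[h3 h4] := dn _ h1 (lt_trans h2 x1b).
  have /andP[h5 h6] := dn _ h3 (lt_trans h4 (lt_trans h2 x1b)).
  by exists (act f^-1%g (act f^-1%g (act f^-1%g x1))); rewrite !actVK.
have xb : x < b by lra.
have [y xy yb|m ym] := iter_pass actP xf _ y1b; first by apply: nf => //; lra.
have [aF Fb] := fX m x ax xb.
have naff : ~ affine_itv (act (f ^+ m)%g) x (act f (act f x)).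
  apply: (commuting_not_affine (x1 := x1) (y1 := y1) actP of_ fup) => //.
  - by apply: affine_itvS fvf.
  - by apply: affine_itvS fwf.
  - by move=> t _ _; rewrite -actXSr // actXS.
  - exact: ltW (lt_trans ff ffx).
  - exact: ltW.
have [B FB] := pl_affine actP (f ^+ m)%g.
have [t [/andP[xt tff] nt]] : exists t, x < t < act f (act f x) /\
    ~ locally_affine (act (f ^+ m)%g) t.
  apply: contrapT => N; apply: naff; apply: (affine_off_locally FB) => t tI _.
  by apply: contrapT => nt; apply: N; exists t.
have [at_ tb] : a < t /\ t < b by split; lra.
exists t; split=> //; first by exists m.
exists m => lst; apply: nt.
have [aFt Ftb] := fX m t at_ tb.
have lt1 : locally_affine (act s) t.
  exists a, x1; split=> //; first lra.
  by apply: affine_itvS svs.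
have lt2 : locally_affine (act s) (act (f ^+ m)%g t).
  exists y1, b; split=> //; first by apply: (lt_trans ym); rewrite act_lt.
  by apply: affine_itvS sws.
have lc : locally_affine (act (s^-1 * (f ^+ m * s))%g) t.
  apply: (locally_affine_mul actP); first exact: (locally_affine_mul actP).
  rewrite (pl_mul actP) -comX //; exact: (locally_affine_inv actP).
apply: (locally_affine_ext at_ tb _ lc) => y /andP[ay yb].
by rewrite (pl_mul actP) (pl_mul actP (f ^+ m)) -(comX m y ay yb) (actK actP).
Qed.

(** A pair [(t, act s t)] of breakpoints of powers of [f] is a code: by freeness, elements agreeing
    at one point of [(a, b)] agree on all of it. *)
Lemma itv_stabilizer_countable u v : a < u -> u < b -> a < v -> v < b ->
  countable [set (act s u, act s v) | s in itv_stabilizer].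
Proof.
move=> au ub av vb.
pose P (X c : R * R) := exists s, [/\ itv_stabilizer s, X = (act s u, act s v),
  a < c.1, c.1 < b & act s c.1 = c.2].
apply: (@countable_code _ _ _ (power_breaks `*` power_breaks) P).
- by apply: countableX; exact: power_breaks_countable.
- move=> _ [s Ss <-]; have [t [at_ tb Pt Pst]] := power_breaks_moved Ss.
  by exists (t, act s t) => //; exists s.
move=> X Y [c c'] _ _ [s [Ss -> /= ac cb sc]] [t [St -> _ _ /= tc]].
have /subgroupP[_ SM SV] := itv_stabilizer_subgroup.
have Sts : itv_stabilizer (t^-1 * s)%g by apply: SM => //; exact: SV.
have fixts y : a < y -> y < b -> act s y = act t y.
  move=> ay yb; have := free Sts ac cb _ ay yb; rewrite !(pl_mul actP) sc -tc actK //.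
  by move=> /(_ erefl) e; rewrite -{2}e actVK.
by rewrite !fixts.
Qed.

End FreeOrbital.

(** * Lines and breakpoints *)

Section CountableGroup.
Variables (R : realType) (G : groupType) (act : G -> R -> R) (H : set G).
Hypotheses (actP : pl_action act) (sH : subgroup H) (nc : no_crossing act H).
Let E := endpoints act H.

Lemma fix_or_orbital f u v x : H f -> (forall t, u <= t -> t <= v -> ~ E t) ->
  u <= x -> x <= v -> act f x <> x ->
  exists a b, [/\ a < u, v < b & orbital act f a b].
Proof.
move=> Hf noE ux xv /(orbital_ex actP)[a [b [ax xb of_]]].
have [Ea Eb] := endpoints_orbital Hf of_.
exists a, b; split=> //; rewrite ltNge; apply/negP => h.
- by apply: (noE a) => //; lra.
- by apply: (noE b) => //; lra.
Qed.

(* When no orbital of [H] begins or ends in [[u, v]], either all the translates of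
   [[u, v]] by [H] are equal or disjoint, or [[u, v]] lies in an orbital containing
   no endpoint, on which its stabilizer acts freely. *)
Lemma gap_countable u v : u < v -> (forall t, u <= t -> t <= v -> ~ E t) ->
  countable [set (act g u, act g v) | g in H].
Proof.
move=> uv noE; have /subgroupP[H1 HM HV] := sH.
have [[f0 [Hf0 f0u f0v f0n]]|N] := pselect (exists f, [/\ H f, act f u < v,
    u < act f v & ~ (act f u = u /\ act f v = v)]); last first.
  (* Translates of [[u, v]] with overlapping interiors coincide here, so a rational inside is a
     code. *)
  pose P (X : R * R) (q : rat) := exists g, [/\ H g, X = (act g u, act g v),
    act g u < ratr q & ratr q < act g v].
  apply: (@countable_code _ _ _ setT P); first exact: countableP.
    move=> _ [g Hg <-]; have := pl_lt actP g uv => /rat_in_itvoo[q].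
    by rewrite in_itv /= => /andP[h1 h2]; exists q => //; exists g.
  move=> _ _ q _ _ [g [Hg -> gu gv]] [h [Hh -> hu hv]].
  have [gh1 gh2] : act (h^-1 * g)%g u = u /\ act (h^-1 * g)%g v = v.
    apply: contrapT => n; apply: N; exists (h^-1 * g)%g.
    by split=> //; rewrite ?(pl_mul actP) ?actV_lt ?act_ltV //;
      [apply: HM => //; exact: HV|exact: lt_trans hv|exact: lt_trans gv].
  have e y : act (h^-1 * g)%g y = y -> act g y = act h y.
    by rewrite (pl_mul actP) => e; rewrite -{2}e actVK.
  by rewrite !e.
have [a [b [au vb of0]]] : exists a b, [/\ a < u, v < b & orbital act f0 a b].
  have [fu|fu] := pselect (act f0 u = u).
    by apply: (fix_or_orbital (x := v)) => // [|e]; [exact: ltW|apply: f0n].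
  by apply: (fix_or_orbital (x := u)) => //; exact: ltW.
have [ub av] : u < b /\ a < v by split; lra.
have [f [Hf of_ fup fuv]] : exists f, [/\ H f, orbital act f a b,
    forall t, a < t -> t < b -> t < act f t & act f u < v].
  have [_ _ _ nf] := of0; have [uf|fu|e] := ltgtP u (act f0 u).
  - by exists f0; split=> // t at_ tb; apply: (orbital_sign actP of0 au ub).
  - exists f0^-1%g; split; rewrite ?actV_lt //; [exact: HV|exact: orbital_inv|].
    move=> t at_ tb; apply: (orbital_sign actP (orbital_inv actP of0) au ub) => //.
    by rewrite act_ltV.
  - by case: (nf u).
have noEuf t : u <= t -> t <= act f u -> ~ E t.
  by move=> ut tf; apply: noE => //; exact: le_trans (ltW fuv).
have HX n : H (f ^+ n)%g by elim: n => [//|n IH]; rewrite expgS; exact: HM.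
have pass t y : a < y -> y < b -> t < b -> exists n, t < act (f ^+ n)%g y.
  move=> ay yb tb; apply: (iter_pass actP (b := b)) => //; first exact: fup.
  by move=> z yz zb; have [_ _ _] := of_; apply => //; exact: lt_trans yz.
(* The translates of [[u, act f u]] by powers of [f] cover [(a, b)], and [E] is invariant. *)
have noEab e : a < e -> e < b -> ~ E e.
  move=> ae eb Ee; have [ue|eu] := leP u e.
    have n_ex : exists n, e < act (f ^+ n)%g u by exact: pass.
    case: (ex_minnP n_ex) => -[|n] en nmin.
      by move: en; rewrite pl_1 // ltNge ue.
    have {nmin} ne : act (f ^+ n)%g u <= e.
      by rewrite leNgt; apply/negP => /nmin; rewrite ltnn.
    apply: (noEuf (act (f ^- n)%g e)).
    + by rewrite -(act_le actP (f ^+ n)%g) actVK.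
    + by rewrite ltW // actV_lt // -actXSr.
    + exact: (endpoints_act actP sH (HV _ (HX n)) Ee).
  have n_ex : exists n, u < act (f ^+ n)%g e by exact: pass.
  case: (ex_minnP n_ex) => -[|n] en nmin.
    by move: en; rewrite pl_1 // => /lt_trans /(_ eu); rewrite ltxx.
  have {nmin} ne : act (f ^+ n)%g e <= u.
    by rewrite leNgt; apply/negP => /nmin; rewrite ltnn.
  apply: (noEuf (act (f ^+ n.+1)%g e)).
  + exact: ltW.
  + by rewrite actXS // act_le.
  + exact: (endpoints_act actP sH (HX n.+1) Ee).
(* An orbital of [s] meeting [(a, b)] has its ends outside, hence contains the fixed point [x]. *)
have free s x y : itv_stabilizer act H a b s -> a < x -> x < b ->
    act s x = x -> a < y -> y < b -> act s y = y.
  move=> [Hs sa sb] ax xb sx ay yb; apply: contrapT.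
  move=> /(orbital_ex actP)[c [d [cy yd os]]].
  have [Ec Ed] := endpoints_orbital Hs os.
  have ca : c <= a by rewrite leNgt; apply/negP => ac; apply: (noEab c) => //; lra.
  have bd : b <= d by rewrite leNgt; apply/negP => db; apply: (noEab d) => //; lra.
  by have [_ _ _ /(_ x)] := os; apply; lra.
have cS := itv_stabilizer_countable actP sH Hf of_ fup free au ub av vb.
(* [rep p] is a fixed element carrying [(a, b)] to [p]; every [g] that does so is [rep p] times an
   element of the stabilizer. *)
have /choice[rep repP] (p : R * R) : exists r, (exists2 g, H g & (act g a, act g b) = p) ->
    H r /\ (act r a, act r b) = p.
  by have [[g Hg gp]|n] := pselect (exists2 g, H g & (act g a, act g b) = p);
    [exists g|exists 1%g].
pose P (X : R * R) (c : (R * R) * (R * R)) := X = (act (rep c.1) c.2.1, act (rep c.1) c.2.2).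
apply: (@countable_code _ _ _ (orbitals act H `*`
  [set (act s u, act s v) | s in itv_stabilizer act H a b]) P).
- by apply: countableX => //; exact: orbitals_countable.
- move=> _ [g Hg <-]; pose p := (act g a, act g b).
  have [|Hr rp] := repP p; first by exists g.
  have [ra rb] : act (rep p) a = act g a /\ act (rep p) b = act g b by case: rp.
  exists (p, (act ((rep p)^-1 * g)%g u, act ((rep p)^-1 * g)%g v)).
    split=> /=; first by apply: (@orbitals_act _ _ _ _ actP sH g (a, b)) => //; exists f.
    exists ((rep p)^-1 * g)%g => //; split; first exact: HM (HV _ Hr) Hg.
    + by rewrite (pl_mul actP) -ra actK.
    + by rewrite (pl_mul actP) -rb actK.
  by rewrite /P /= !(pl_mul actP) !actVK.
by move=> X Y c _ _ -> ->.
Qed.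

Definition lines_on (u v : R) : set (R * R) := [set l | exists2 g, H g &
  forall x, u <= x <= v -> act g x = l.1 * x + l.2].

Lemma lines_on_countable_of u v x y : u <= x -> x < y -> y <= v ->
  countable [set (act g x, act g y) | g in H] -> countable (lines_on u v).
Proof.
move=> ux xy yv cxy.
apply: (countable_code (P := fun l c => l.1 * x + l.2 = c.1 /\ l.1 * y + l.2 = c.2) cxy).
  move=> l [g Hg gl]; exists (act g x, act g y); first by exists g.
  by split; rewrite /= gl //; apply/andP; split; lra.
move=> [al be] [al' be'] c _ _ /= [h1 h2] [h3 h4].
by have [|| -> ->] := @affine_coef_uniq _ al be al' be' x y xy; rewrite ?h1 ?h2.
Qed.

Lemma lines_on_countable u v : u < v -> countable (lines_on u v).
Proof.
move=> uv; pose w := (u + v) / 2.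
have gapl x y : u <= x -> x < y -> y <= v -> (forall t, x < t -> t < y -> ~ E t) ->
    countable (lines_on u v).
  move=> ux xy yv noE.
  (* The points at one and two thirds bound a closed interval free of [E]. *)
  apply: (@lines_on_countable_of u v ((x + x + y) / 3) ((x + y + y) / 3)); try lra.
  by apply: gap_countable; [lra|move=> t h1 h2; apply: noE; lra].
(* Either one half of [(u, v)] is free of [E], or each half supplies a point of [E], whose images
   stay in the countable set [E]. *)
have [e1|N1] := pselect (exists t, [/\ u < t, t < w & E t]); last first.
  by apply: (gapl u w); rewrite /w; try lra; move=> t h1 h2 Et; apply: N1; exists t.
have [e2|N2] := pselect (exists t, [/\ w < t, t < v & E t]); last first.
  by apply: (gapl w v); rewrite /w; try lra; move=> t h1 h2 Et; apply: N2; exists t.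
case: e1 => x [ux xw Ex]; case: e2 => y [wy yv Ey].
apply: (@lines_on_countable_of u v x y); try lra.
have cE : countable E by exact: endpoints_countable.
apply: (countable_subset _ (countableX cE cE)).
by move=> _ [g Hg <-]; split=> /=; exact: endpoints_act.
Qed.

Definition lines : set (R * R) := [set l | exists u v, u < v /\ lines_on u v l].

Lemma lines_countable : countable lines.
Proof.
apply: (countable_subset (B := \bigcup_(c in [set c : rat * rat | c.1 < c.2])
  lines_on (ratr c.1) (ratr c.2))).
  move=> l [u [v [uv [g Hg gl]]]].
  have [q] := rat_in_itvoo uv; rewrite in_itv /= => /andP[uq qv].
  have [r] := rat_in_itvoo qv; rewrite in_itv /= => /andP[qr rv].
  exists (q, r) => /=; first by rewrite -(ltr_rat R).
  by exists g => // x /andP[qx xr]; apply: gl; apply/andP; split; lra.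
apply: bigcup_countable; first exact: countableP.
by move=> c cc; apply: lines_on_countable; rewrite ltr_rat.
Qed.

(** Abscissas of intersections of two lines; parallel pairs contribute only the point 0, the value
    of division by zero. *)
Definition line_meets : set R :=
  [set (p.2.2 - p.1.2) / (p.1.1 - p.2.1) | p in lines `*` lines].

Lemma line_meets_countable : countable line_meets.
Proof. by apply: countable_img; apply: countableX; exact: lines_countable. Qed.

Lemma right_line g t : H g -> exists l v, [/\ lines l, t < v &
  forall x, t <= x <= v -> act g x = l.1 * x + l.2].
Proof.
move=> Hg; have [B gB] := pl_affine actP g.
have [v tv [al [be gE]]] := affine_off_right t gB.
by exists (al, be), v; split=> //; exists t, v; split=> //; exists g.
Qed.

(** The lines left and right of [t] meet above [t]; with equal slopes they would coincide, and [g]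
    would be affine near [t]. *)
Lemma break_meets g t : H g -> ~ locally_affine (act g) t -> line_meets t.
Proof.
move=> Hg nt; have [B gB] := pl_affine actP g.
have [[al be] [v [Ll tv /= gl]]] := right_line t Hg.
have [u ut [al' [be' gl']]] := affine_off_left t gB.
have e : al * t + be = al' * t + be'.
  by rewrite -gl ?lexx ?ltW // gl' // lexx andbT ltW.
have al0 : al - al' != 0.
  apply/eqP => al0; apply: nt; exists u, v; split=> //; exists al, be => x /andP[ux xv].
  have [tx|xt] := leP t x; first by rewrite gl // tx.
  rewrite gl' ?ux ?ltW //.
  have ea : al' = al by lra.
  by rewrite ea; congr (_ + _); move: e; rewrite ea; lra.
exists ((al, be), (al', be')) => /=.
  by split=> //=; exists u, t; split=> //; exists g.
by apply: (mulIf al0); rewrite mulfVK //; lra.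
Qed.

Lemma affine_off_filter (F : R -> R) B : affine_off F B ->
  affine_off F [seq b <- B | `[< ~ locally_affine F b >]].
Proof.
move=> FB u v uv uvB; apply: (affine_off_locally FB) => t tI tB.
apply: contrapT => nt; apply: (uvB t) => //.
by rewrite mem_filter tB andbT; apply/asboolP.
Qed.

Lemma nearest_left (B : seq R) m x : m < x ->
  exists u, [/\ u \in m :: B, u < x & forall b, b \in B -> ~ (u < b < x)].
Proof.
move=> mx; elim: B => [|b B [u [uB ux un]]]; first by exists m; split; rewrite ?inE ?eqxx.
have [/andP[ub bx]|nb] := boolP (u < b < x).
  exists b; split=> //; first by rewrite !inE eqxx orbT.
  move=> b'; rewrite inE => /orP[/eqP ->|/un h]; first by rewrite ltxx.
  by move=> /andP[bb' bx']; apply: h; rewrite bx' andbT; exact: lt_trans bb'.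
exists u; split=> //; first by move: uB; rewrite !inE => /orP[->//|->]; rewrite !orbT.
by move=> b'; rewrite inE => /orP[/eqP ->|/un//]; exact/negP.
Qed.

Lemma nearest_right (B : seq R) m x : x < m ->
  exists v, [/\ v \in m :: B, x < v & forall b, b \in B -> ~ (x < b < v)].
Proof.
move=> xm; have [|u [uB ux un]] := @nearest_left (map -%R B) (- m) (- x).
  by rewrite ltrN2.
exists (- u); split; last 2 first.
- lra.
- by move=> b bB /andP[h1 h2]; apply: (un (- b)); [exact: map_f|apply/andP; split; lra].
by move: uB; rewrite -(map_cons -%R) => /mapP[y yB ->]; rewrite opprK.
Qed.

Lemma affine_off_determined (F F' : R -> R) B m M x :
  affine_off F B -> affine_off F' B -> m \in B -> M \in B -> m < x -> x < M ->
  (forall b, b \in B -> F b = F' b) -> F x = F' x.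
Proof.
move=> FB F'B mB MB mx xM e; have [xB|xB] := boolP (x \in B); first exact: e.
have [u [uB ux un]] := nearest_left B mx; have [v [vB xv vn]] := nearest_right B xM.
have {}uB : u \in B by move: uB; rewrite inE => /orP[/eqP ->|].
have {}vB : v \in B by move: vB; rewrite inE => /orP[/eqP ->|].
have uv : u < v by exact: lt_trans xv.
have Buv b : b \in B -> ~ (u < b < v).
  move=> bB /andP[ub bv]; have [bx|xb|bx] := ltgtP b x.
  - by apply: (un b); rewrite // ub.
  - by apply: (vn b); rewrite // xb.
  - by rewrite -bx bB in xB.
apply: (affine_eq2 (FB _ _ uv Buv) (F'B _ _ uv Buv) (lexx u) uv (lexx v)); try exact: e.
by rewrite !ltW.
Qed.

Lemma no_crossing_countable :
  (forall f g, act f =1 act g -> f = g) -> countable H.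
Proof.
move=> faithful; have [m0 [M0 bd0]] := pl_bounded actP.
pose m := Num.min m0 0; pose M := Num.max M0 1.
have bd f x : x <= m \/ M <= x -> act f x = x.
  move=> h; apply: bd0; move: h; rewrite /m /M le_min ge_max.
  by case=> /andP[h1 h2]; [left|right].
pose X : set R := line_meets `|` [set m; M].
have cX : countable X.
  have cmM : countable [set m; M] by apply: finite_set_countable; exact: finite_set2.
  apply: (countable_subset (B := \bigcup_(i in [set: bool])
    if i then line_meets else [set m; M])).
    by move=> x [h|h]; [exists true|exists false].
  by apply: bigcup_countable => // -[] _ //; exact: line_meets_countable.
(* A countable set containing all graph points above [X]: right of each point, an element of [H]
   follows one of the lines. *)
pose Z : set (R * R) := [set (p.1, p.2.1 * p.1 + p.2.2) | p in X `*` lines].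
have /countable_injP[code cinj] : countable Z.
  by apply: countable_img; apply: countableX => //; exact: lines_countable.
have inZ g x : H g -> X x -> Z (x, act g x).
  move=> Hg Xx; have [l [v [Ll xv gl]]] := right_line x Hg.
  by exists (x, l) => //=; rewrite gl // lexx ltW.
(* An element is coded by finitely many points of its graph, among them those above its
   breakpoints. *)
pose P g (s : seq nat) := exists B, [/\ affine_off (act g) B, m \in B, M \in B,
  (forall b, b \in B -> X b) & s = [seq code (b, act g b) | b <- B]].
apply: (@countable_code _ _ _ setT P); first exact: countableP.
  move=> g Hg; have [B gB] := pl_affine actP g.
  (* Only genuine breakpoints are kept, since these are known to lie in [X]. *)
  pose B' := [:: m, M & [seq b <- B | `[< ~ locally_affine (act g) b >]]].
  exists [seq code (b, act g b) | b <- B'] => //; exists B'; split=> //.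
  - move=> u v uv uvB; apply: (affine_off_filter gB) => // b bB.
    by apply: uvB; rewrite !inE bB !orbT.
  - by rewrite !inE eqxx.
  - by rewrite !inE eqxx orbT.
  - move=> b; rewrite !inE => /or3P[/eqP ->|/eqP ->|].
    + by right; left.
    + by right; right.
    + by rewrite mem_filter => /andP[/asboolP nb _]; left; exact: (break_meets Hg).
move=> g g' s Hg Hg' [B [gB mB MB XB ->]] [B' [gB' _ _ XB' e]].
have sz : size B = size B' by rewrite -(size_map (fun b => code (b, act g b))) e size_map.
have ptw i : (i < size B)%N -> (B`_i, act g B`_i) = (B'`_i, act g' B'`_i).
  move=> iB; apply: cinj; rewrite ?inE.
  - by apply: inZ => //; apply: XB; exact: mem_nth.
  - by apply: inZ => //; apply: XB'; apply: mem_nth; rewrite -sz.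
  - have := congr1 (fun s => nth 0%N s i) e.
    by rewrite (nth_map 0) // (nth_map 0) // -sz.
have BB : B = B' by apply: (eq_from_nth (x0 := 0)) => // i /ptw[].
have {ptw}gg b : b \in B -> act g b = act g' b.
  by move=> /(nthP 0)[i iB <-]; have [e1 e2] := ptw i iB; rewrite e2 -e1.
apply: faithful => x; have [xm|mx] := leP x m; first by rewrite !bd //; left.
have [Mx|xM] := leP M x; first by rewrite !bd //; right.
by rewrite -BB in gB'; exact: (affine_off_determined gB gB' mB MB).
Qed.

End CountableGroup.

(** * The action of PLo on the line *)

Section PLoAction.
Variable R : realType.
Local Notation I := (unit_itv R).
Implicit Types f g : PLo R.

(* The extension of [f] to [R] by the identity outside of [[0, 1]]. *)
Definition PLo_act f (x : R) : R := oapp (fun y : I => \val (f y)) x (insub x).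

Lemma PLo_act_val f (y : I) : PLo_act f (\val y) = \val (f y).
Proof. by rewrite /PLo_act valK. Qed.

Lemma PLo_act_out f x : ~ (0 <= x <= 1) -> PLo_act f x = x.
Proof. by rewrite /PLo_act; case: insubP => //= y _ <- []; exact: unit_itvP. Qed.

Variant unit_itv_spec (x : R) : Prop :=
| UnitItvIn (y : I) of x = \val y
| UnitItvOut of ~ (0 <= x <= 1).

Lemma unit_itv_case x : unit_itv_spec x.
Proof.
have [/unit_itv_ex[y yx]|/negP nx] := boolP (0 <= x <= 1); last exact: UnitItvOut.
exact: (UnitItvIn (y := y)).
Qed.

Lemma PLo_actM f g x : PLo_act (f * g)%g x = PLo_act f (PLo_act g x).
Proof.
by case: (unit_itv_case x) => [y ->|nx]; rewrite ?PLo_act_val // !PLo_act_out.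
Qed.

Lemma PLo_act1 x : PLo_act 1%g x = x.
Proof. by case: (unit_itv_case x) => [y ->|nx]; rewrite ?PLo_act_val // PLo_act_out. Qed.

Lemma PLo_act_lt f x y : x < y -> PLo_act f x < PLo_act f y.
Proof.
have [_ fo _] := set_mem (svalP f).
case: (unit_itv_case x) => [x' ->|nx]; case: (unit_itv_case y) => [y' ->|ny] xy;
  rewrite ?PLo_act_val ?(PLo_act_out f nx) ?(PLo_act_out f ny) //.
- exact: fo.
- have /andP[_ h] := unit_itvP (f x'); have /andP[h' _] := unit_itvP x'.
  rewrite ltNge; apply/negP => yf; apply: ny; apply/andP; split; lra.
- have /andP[h _] := unit_itvP (f y'); have /andP[_ h'] := unit_itvP y'.
  rewrite ltNge; apply/negP => yf; apply: nx; apply/andP; split; lra.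
Qed.

(** At the end 0, monotonicity gives [f 0 <= f (f^-1 0) = 0]; the end 1 is similar. *)
Lemma PLo_act_bounded f x : x <= 0 \/ 1 <= x -> PLo_act f x = x.
Proof.
have le01 : (0 : R) <= 1 by exact: ler01.
have in01 g y : 0 <= y <= 1 -> 0 <= PLo_act g y <= 1.
  by move=> /unit_itv_ex[z <-]; rewrite PLo_act_val unit_itvP.
have le g y z : y <= z -> PLo_act g y <= PLo_act g z.
  by rewrite le_eqVlt => /orP[/eqP -> //|/(PLo_act_lt g)/ltW].
have K y : PLo_act f (PLo_act f^-1%g y) = y by rewrite -PLo_actM mulgV PLo_act1.
have I0 : 0 <= (0 : R) <= 1 by rewrite lexx.
have I1 : 0 <= (1 : R) <= 1 by rewrite lexx andbT.
move=> [x0|x1].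
  have [e|/eqP nx] := eqVneq x 0; last by apply: PLo_act_out => /andP[h _]; apply: nx; lra.
  rewrite e; apply/eqP; rewrite eq_le.
  have /andP[-> _] := in01 f 0 I0; rewrite andbT -{2}(K 0) le //.
  by have /andP[] := in01 f^-1%g 0 I0.
have [e|/eqP nx] := eqVneq x 1; last by apply: PLo_act_out => /andP[_ h]; apply: nx; lra.
rewrite e; apply/eqP; rewrite eq_le.
have /andP[_ ->] := in01 f 1 I1; rewrite /= -{1}(K 1) le //.
by have /andP[] := in01 f^-1%g 1 I1.
Qed.

Lemma partition_piece (s : seq R) a u : path <%R a s -> a <= u -> u < last a s ->
  exists2 i, (i < size s)%N & (a :: s)`_i <= u < (a :: s)`_i.+1.
Proof.
elim: s a => [|b s IH] a /=; first by move=> _ au /(le_lt_trans au); rewrite ltxx.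
move=> /andP[ab bs] au ul; have [ub|bu] := ltP u b.
  by exists 0%N => //=; rewrite au ub.
by have [i si ui] := IH _ bs bu ul; exists i.+1.
Qed.

Lemma PLo_act_affine f : exists B, affine_off (PLo_act f) B.
Proof.
have [_ _ [s [[ps /eqP ls] afs]]] := set_mem (svalP f).
(* This list contains 0 and 1, so an interval avoiding it lies in one piece of the partition or
   outside [[0, 1]]. *)
exists (0 :: s) => u v uv uvB.
have s1 : 1 \in 0 :: s by rewrite -ls; exact: mem_last.
have idI : (forall x, u <= x <= v -> PLo_act f x = x) -> affine_itv (PLo_act f) u v.
  by move=> h; exists 1, 0 => x /h ->; rewrite mul1r addr0.
have [v0|v0] := leP v 0.
  by apply: idI => x /andP[_ xv]; apply: PLo_act_bounded; left; lra.
have [u1|u1] := leP 1 u.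
  by apply: idI => x /andP[ux _]; apply: PLo_act_bounded; right; lra.
have u0 : 0 <= u.
  by rewrite leNgt; apply/negP => h; apply: (uvB 0); rewrite ?inE ?eqxx // h.
have [|i si /andP[iu ui]] := partition_piece ps u0; first by rewrite ls.
have vi : v <= (0 :: s)`_i.+1.
  rewrite leNgt; apply/negP => iv; apply: (uvB (0 :: s)`_i.+1); last by rewrite ui.
  exact: mem_nth.
have [al [be E]] := afs i si; exists al, be => x /andP[ux xv].
have [y yx] : exists y : I, \val y = x.
  apply: unit_itv_ex; rewrite (le_trans u0 ux) /= (le_trans xv) // leNgt.
  by apply/negP => v1; apply: (uvB 1); rewrite // u1.
by rewrite -yx PLo_act_val E // yx (le_trans iu ux) (le_trans xv).
Qed.

Lemma PLo_pl_action : pl_action PLo_act.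
Proof.
split.
- exact: PLo_actM.
- exact: PLo_act1.
- exact: PLo_act_lt.
- by exists 0, 1; exact: PLo_act_bounded.
- exact: PLo_act_affine.
Qed.

Lemma PLo_act_faithful f g : PLo_act f =1 PLo_act g -> f = g.
Proof.
move=> fg; apply: PLo_ext; apply/funext => y; apply: val_inj.
by rewrite -!PLo_act_val fg.
Qed.

End PLoAction.

Theorem theorem1p4 (R : realType) (H : set (PLo R)) :
  subgroup H -> locally_solvable H -> countable H.
Proof.
move=> sH lH; apply: (no_crossing_countable (@PLo_pl_action R) sH).
  by move=> g h a b c d; exact: (locally_solvable_no_crossing (@PLo_pl_action R) sH lH).
exact: PLo_act_faithful.
Qed.
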